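(* Let $(X_n,x_n)$, $n\ge1$, and $(X,x)$ be pointed maximal Gromov hyperbolic spaces with finite boundaries. Then $(X_n,x_n)\to(X,x)$ in the pointed Gromov-Hausdorff sense if and only if $(\partial X_n,\rho_{x_n})\to(\partial X,\rho_x)$ in the sense of almost-isometric convergence.
   Context: **Semi-metric and antipodal spaces.** A compact semi-metric space $(Z,\rho)$ is a compact metrizable space $Z$ with at least four points together with a continuous symmetric function $\rho:Z\times Z\to[0,\infty)$ with $\rho(\xi,\eta)=0$ iff $\xi=\eta$. It is an antipodal space if moreover $\sup_{\xi,\eta}\rho(\xi,\eta)=1$ and for every $\xi\in Z$ there is $\eta\in Z$ with $\rho(\xi,\eta)=1$. The cross-ratio is $[\xi,\xi',\eta,\eta']_\rho=\frac{\rho(\xi,\eta)\rho(\xi',\eta')}{\rho(\xi,\eta')\rho(\xi',\eta)}$ for distinct points; a Moebius homeomorphism is a homeomorphism preserving cross-ratios. **Maximal Gromov hyperbolic spaces.** A good Gromov hyperbolic space is a Gromov hyperbolic metric space that is proper, geodesic, geodesically complete (every geodesic segment extends to a bi-infinite geodesic) and boundary continuous (for each $x$ the Gromov product $(y|z)_x=\frac12(d(y,x)+d(z,x)-d(y,z))$ extends continuously to the Gromov boundary $\partial X$). For such $X$ and $x\in X$, $\rho_x=\exp(-(\cdot|\cdot)_x)$ on $\partial X$; $(\partial X,\rho_x)$ is an antipodal space (boundaries are understood to have at least four points), and the cross-ratio of $\rho_x$ does not depend on $x$. A maximal Gromov hyperbolic space is a good Gromov hyperbolic space $X$ such that for every good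 Gromov hyperbolic space $Y$ and every Moebius homeomorphism $g:\partial Y\to\partial X$, $g$ extends to an isometric embedding $Y\to X$. **Almost-isometric (AI) convergence.** For $\epsilon>0$, an $\epsilon$-isometry $f:(Z_1,\rho_1)\to(Z_2,\rho_2)$ between compact semi-metric spaces is a (not necessarily continuous) map with $\sup_{\xi,\eta\in Z_1}|\rho_2(f(\xi),f(\eta))-\rho_1(\xi,\eta)|<\epsilon$ and such that every point $\eta\in Z_2$ satisfies $\rho_2(f(\zeta),\eta)<\epsilon$ for some $\zeta\in Z_1$. Let $d_{AI}((Z_1,\rho_1),(Z_2,\rho_2))$ be the infimum of $\epsilon>0$ for which there are $\epsilon$-isometries $Z_1\to Z_2$ and $Z_2\to Z_1$. AI-convergence $(Z_n,\rho_n)\to(Z,\rho_0)$ means $d_{AI}((Z_n,\rho_n),(Z,\rho_0))\to0$. **Pointed Gromov-Hausdorff convergence.** A map $f:X\to Y$ of metric spaces (not necessarily continuous) is an $\epsilon$-isometry if $\sup_{x_1,x_2}|d_Y(f(x_1),f(x_2))-d_X(x_1,x_2)|<\epsilon$ and $Y=\bigcup_{x\in X}B_Y(f(x),\epsilon)$. For pointed proper geodesic metric spaces, $(X_n,p_n)\to(X,p)$ means: for every $R>0$ and $\epsilon>0$ there is $n_0$ such that for all $n\ge n_0$ there is an $\epsilon$-isometry $f:B_{X_n}(p_n,R)\to B_X(p,R)$ with $f(p_n)=p$. Balls $B_X(p,R)$ are closed. *)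

(* Defs.v *)
From HB Require Import structures.
From mathcomp Require Import all_boot all_order all_algebra.
From mathcomp Require Import all_classical all_reals all_analysis.

Set Implicit Arguments.
Unset Strict Implicit.
Unset Printing Implicit Defensive.

Import Order.TTheory GRing.Theory Num.Theory.
Import numFieldNormedType.Exports.

Local Open Scope classical_set_scope.
Local Open Scope ring_scope.

Section Geodesics.
Context {R : realType} {X : metricType R}.
Implicit Types (o x y z : X) (c : R -> X).

(* [closed_ball] of the library is the closure of the open ball, which may be
   strictly smaller in a general metric space. *)
Definition cball x (r : R) : set X := [set y | mdist x y <= r].

Definition gromov_product x y z : R :=
  (mdist y x + mdist z x - mdist y z) / 2.

Definition isometric_on (D : set R) c : Prop :=
  forall s t, D s -> D t -> mdist (c s) (c t) = `|s - t|.

(* A ray is given by a map on all of R whose values at negative times are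
   irrelevant. *)
Definition is_ray c : Prop := isometric_on [set t | 0 <= t] c.

Definition asymptotic c c' : Prop :=
  exists C : R, forall t, 0 <= t -> mdist (c t) (c' t) <= C.

Definition ray_class c : set (R -> X) :=
  [set c' | is_ray c' /\ asymptotic c c'].

End Geodesics.

Section Hyperbolic.
Context {R : realType}.
Variable X : metricType R.

Definition gromov_hyperbolic : Prop :=
  exists delta : R, forall o x y z : X,
    Num.min (gromov_product o x y) (gromov_product o y z) - delta
      <= gromov_product o x z.

Definition proper_space : Prop := forall (x : X) (r : R), compact (cball x r).

Definition geodesic_space : Prop :=
  forall x y : X, exists c : R -> X,
    [/\ isometric_on `[0, mdist x y] c, c 0 = x & c (mdist x y) = y].

Definition geodesically_complete : Prop :=
  forall (a b : R) (c : R -> X), a <= b -> isometric_on `[a, b] c ->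
    exists2 c' : R -> X, isometric_on setT c' &
      forall t, t \in `[a, b] -> c' t = c t.

(* The Gromov boundary: asymptoty classes of geodesic rays. *)
Definition boundary : Type :=
  {xi : set (R -> X) | exists2 c, is_ray c & xi = ray_class c}.

HB.instance Definition _ := gen_eqMixin boundary.
HB.instance Definition _ := gen_choiceMixin boundary.

Definition bordification : Type := (X + boundary)%type.

HB.instance Definition _ := Choice.copy bordification (X + boundary)%type.

(* Basic neighbourhoods of the boundary point [xi], as seen from [o]: points
   whose Gromov product with [xi], computed along rays, is at least [r]. *)
Definition shadow (o : X) (xi : boundary) (r : R) : set bordification :=
  [set z | match z with
    | inl y => exists2 c, sval xi c &
        exists T : R, forall t, T <= t -> r <= gromov_product o y (c t)
    | inr eta => exists c c', [/\ sval xi c, sval eta c' &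
        exists T : R, forall s t, T <= s -> T <= t ->
          r <= gromov_product o (c s) (c' t)]
    end].

Definition bordification_open (U : set bordification) : Prop :=
  (forall y : X, U (inl y) -> exists2 e : R, 0 < e &
     forall y', ball y e y' -> U (inl y')) /\
  (forall xi : boundary, U (inr xi) ->
     forall o : X, exists r : R, shadow o xi r `<=` U).

Lemma shadowS o xi r r' : r <= r' -> shadow o xi r' `<=` shadow o xi r.
Proof.
move=> rr' [y|eta] /=.
- move=> [c xic [T HT]]; exists c => //; exists T => t Tt.
  exact: le_trans rr' (HT _ Tt).
- move=> [c [c' [xic etac [T HT]]]]; exists c, c'; split => //.
  by exists T => s t Ts Tt; exact: le_trans rr' (HT _ _ Ts Tt).
Qed.

Lemma bordification_openT : bordification_open setT.
Proof.
split=> [y _|xi _ o]; first by exists 1.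
by exists 0.
Qed.

Lemma bordification_openI (U V : set bordification) :
  bordification_open U -> bordification_open V -> bordification_open (U `&` V).
Proof.
move=> [UX Ub] [VX Vb]; split=> [y [Uy Vy]|xi [Uxi Vxi] o].
- have [e e0 eU] := UX _ Uy; have [e' e'0 eV] := VX _ Vy.
  exists (Num.min e e'); first by rewrite lt_min e0.
  move=> y' yy'; split.
  + by apply: eU; apply: le_ball yy'; rewrite ge_min lexx.
  + by apply: eV; apply: le_ball yy'; rewrite ge_min lexx orbT.
- have [r rU] := Ub _ Uxi o; have [r' rV] := Vb _ Vxi o.
  exists (Num.max r r') => z zs; split.
  + by apply: rU; apply: shadowS zs; rewrite le_max lexx.
  + by apply: rV; apply: shadowS zs; rewrite le_max lexx orbT.
Qed.

Lemma bordification_open_bigU (I : Type) (f : I -> set bordification) :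
  (forall i, bordification_open (f i)) -> bordification_open (\bigcup_i f i).
Proof.
move=> fo; split=> [y [i _ fiy]|xi [i _ fixi] o].
- have [e e0 He] := (fo i).1 _ fiy.
  by exists e => // y' yy'; exists i => //; exact: He.
- have [r Hr] := (fo i).2 _ fixi o.
  by exists r => z zs; exists i => //; exact: Hr.
Qed.

HB.instance Definition _ := @isOpenTopological.Build bordification
  bordification_open bordification_openT bordification_openI
  bordification_open_bigU.

HB.instance Definition _ := Topological.copy boundary
  (initial_topology (inr : boundary -> bordification)).

Definition continuous_gromov_extension (x : X)
    (G : bordification * bordification -> \bar R) : Prop :=
  continuous G /\
  forall y z : X, G (inl y, inl z) = (gromov_product x y z)%:E.

Definition boundary_continuous : Prop :=
  forall x : X, exists G, continuous_gromov_extension x G.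

Definition good_hyperbolic : Prop :=
  [/\ gromov_hyperbolic, proper_space & geodesic_space] /\
  [/\ geodesically_complete, boundary_continuous &
      exists s : 'I_4 -> boundary, injective s].

(* Unique when it exists, since X is dense in its bordification. *)
Definition ext_gromov_product (x : X) :
    bordification * bordification -> \bar R :=
  xget (fun=> 0%E) [set G | continuous_gromov_extension x G].

(* rho_x = exp (- (.|.)_x), with exp (-oo) = 0 on the diagonal. *)
Definition visual (x : X) (xi eta : boundary) : R :=
  fine (expeR (- ext_gromov_product x (inr xi, inr eta))%E).

End Hyperbolic.

Definition cross_ratio {R : realType} {Z : Type} (rho : Z -> Z -> R)
    (xi xi' eta eta' : Z) : R :=
  (rho xi eta * rho xi' eta') / (rho xi eta' * rho xi' eta).

Section Maximal.
Context {R : realType}.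

Definition homeomorphism (S T : topologicalType) (g : S -> T) : Prop :=
  exists h : T -> S, [/\ cancel g h, cancel h g, continuous g & continuous h].

(* All base points are allowed, as the cross-ratio does not depend on them. *)
Definition moebius_homeo (Y X : metricType R)
    (g : boundary Y -> boundary X) : Prop :=
  homeomorphism g /\
  forall (y : Y) (x : X) (xi xi' eta eta' : boundary Y),
    uniq [:: xi; xi'; eta; eta'] ->
    cross_ratio (visual x) (g xi) (g xi') (g eta) (g eta') =
    cross_ratio (visual y) xi xi' eta eta'.

Definition isometric_embedding (Y X : metricType R) (F : Y -> X) : Prop :=
  forall y z : Y, mdist (F y) (F z) = mdist y z.

(* [g] is the map induced by the isometric embedding [F] on boundaries: if the
   ray [c] represents [xi], then the ray [F \o c] represents [g xi]. *)
Definition extends_to (Y X : metricType R)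
    (g : boundary Y -> boundary X) (F : Y -> X) : Prop :=
  forall (xi : boundary Y) (c : R -> Y), sval xi c -> sval (g xi) (F \o c).

Definition maximal_hyperbolic (X : metricType R) : Prop :=
  good_hyperbolic X /\
  forall (Y : metricType R) (g : boundary Y -> boundary X),
    good_hyperbolic Y -> moebius_homeo g ->
    exists2 F : Y -> X, isometric_embedding F & extends_to g F.

End Maximal.

Section Convergence.
Context {R : realType}.

Definition AI_isometry (Z1 Z2 : Type) (rho1 : Z1 -> Z1 -> R)
    (rho2 : Z2 -> Z2 -> R) (e : R) (f : Z1 -> Z2) : Prop :=
  (ereal_sup [set `|rho2 (f p.1) (f p.2) - rho1 p.1 p.2|%:E
             | p in [set: Z1 * Z1]] < e%:E)%E /\
  forall eta : Z2, exists zeta : Z1, rho2 (f zeta) eta < e.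

(* Extended-real valued, so that the infimum of the empty set is +oo. *)
Definition AI_distance (Z1 Z2 : Type) (rho1 : Z1 -> Z1 -> R)
    (rho2 : Z2 -> Z2 -> R) : \bar R :=
  ereal_inf [set e%:E | e in [set e : R | [/\ 0 < e,
    exists f, AI_isometry rho1 rho2 e f &
    exists f, AI_isometry rho2 rho1 e f]]].

Definition AI_cvg (Z_ : nat -> Type) (rho_ : forall n, Z_ n -> Z_ n -> R)
    (Z : Type) (rho : Z -> Z -> R) : Prop :=
  (AI_distance (rho_ n) rho @[n --> \oo] --> (0 : \bar R))%E.

(* [f] restricts to an [e]-isometry from the subspace [A] to the subspace
   [B]. *)
Definition GH_isometry (X Y : metricType R) (A : set X) (B : set Y) (e : R)
    (f : X -> Y) : Prop :=
  [/\ forall x, A x -> B (f x),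
      (ereal_sup [set `|mdist (f p.1) (f p.2) - mdist p.1 p.2|%:E
                 | p in A `*` A] < e%:E)%E &
      forall y, B y -> exists2 x, A x & mdist (f x) y <= e].

Definition pointed_GH_cvg (X_ : nat -> metricType R) (p_ : forall n, X_ n)
    (X : metricType R) (p : X) : Prop :=
  forall r e : R, 0 < r -> 0 < e ->
    exists n0 : nat, forall n, (n0 <= n)%N ->
      exists f : X_ n -> X,
        GH_isometry (cball (p_ n) r) (cball p r) e f /\ f (p_ n) = p.

End Convergence.

(* Main.v *)
Require Import Defs.
From HB Require Import structures.
From mathcomp Require Import all_boot all_order all_algebra.
From mathcomp Require Import all_classical all_reals all_analysis.
From mathcomp Require Import lra.

(** A maximal Gromov hyperbolic space [X] with finite boundary [Z] is isometric to
    the tight span of the matrix [D = -2 log rho_x] indexed by [Z], i.e. the set of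
    maximal vectors [u] with [u_i + u_j <= D_ij] for [i != j], with the sup norm:
    Busemann functions embed [X] isometrically into the tight span, the tight span
    is itself a good space with the same Moebius boundary, and maximality makes the
    embedding onto.  The tight span is a 1-Lipschitz retract of the space of all
    vectors, which yields its geodesics and its compact balls; away from a bounded
    core it is a disjoint union of rays, one for each boundary point.

    Both notions of convergence are then equivalent to the existence, for large
    [n], of a surjection [Z_n -> Z] whose fibres are clusters with very large [D]
    and which almost preserves [D] between distinct fibres.  Such a surjection gives
    maps between the spans by reindexing and retracting.  Conversely, an
    approximation of large balls sends the points at distance [r] from the base point
    in the direction of [i] to a single end of the limit, which defines the image of
    [i]. *)

Set Implicit Arguments.
Unset Strict Implicit.
Unset Printing Implicit Defensive.

Import Order.TTheory GRing.Theory Num.Theory.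
Import numFieldNormedType.Exports.

Local Open Scope classical_set_scope.
Local Open Scope ring_scope.


(** * Tight spans *)

(** The tight span comes from the change of base point: moving from [x] to [y] subtracts the
    Busemann values [u_i + u_j] from [D_ij], and the result is again the matrix of an antipodal
    space, that is, nonnegative with a zero off the diagonal in every row. The obstacle in the
    convergence part is uniformity: neither the number of points of [Z_n] nor the entries of its
    matrix are bounded, so the constants may depend only on a bound [K] of the entries of the limit
    matrix. This suffices because two coordinates of a point of the limit span cannot both exceed
    [K]: a coordinate above [K] names an end, and distances between such points are explicit in
    their coordinates. An approximation of balls of radius slightly above [K] therefore already
    detects the ends, although the approximating maps are not continuous and do not act on
    boundaries. *)

Section RowNorm.
Context {R : realType} {k : nat}.
Implicit Types u v : 'rV[R]_k.

Lemma rV_normP u (r : R) : 0 <= r ->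
  `|u| <= r <-> forall i, `|u 0 i| <= r.
Proof.
move=> r0; have -> : `|u| = mx_norm u by [].
rewrite mx_normrE; split => [/bigmax_leP[_ h] i|h]; first exact: (h (0, i)).
by apply/bigmax_leP; split => // -[a i] _ /=; rewrite (ord1 a).
Qed.

Lemma rV_norm_ge u i : `|u 0 i| <= `|u|.
Proof. by move: i; apply/rV_normP. Qed.

Lemma rV_dist_ge u v i : `|u 0 i - v 0 i| <= `|u - v|.
Proof. by have := rV_norm_ge (u - v) i; rewrite !mxE. Qed.

Lemma rV_distP u v (r : R) : 0 <= r ->
  `|u - v| <= r <-> forall i, `|u 0 i - v 0 i| <= r.
Proof.
by move=> r0; rewrite (rV_normP _ r0); split=> h i; have := h i; rewrite !mxE.
Qed.

End RowNorm.

Lemma rV_norm_attained {R : realType} {k : nat} (u : 'rV[R]_k.+1) :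
  exists i, `|u| = `|u 0 i|.
Proof.
have -> : `|u| = mx_norm u by [].
have [u0|/mx_norm_neq0[[a i] /= ->]] := eqVneq (mx_norm u) 0.
  by exists ord0; rewrite u0 (mx_norm_eq0 u0) mxE normr0.
by exists i; rewrite (ord1 a).
Qed.

Section TightSpan.
Context {R : realType} {n : nat}.
Notation k := n.+2.
Notation V := 'rV[R]_k.
Variable D : 'I_k -> 'I_k -> R.
Implicit Types (u v w : V) (i j l : 'I_k).

Definition feasible u := forall i j, i != j -> u 0 i + u 0 j <= D i j.

Definition tight_at u i := exists2 j, j != i & u 0 i + u 0 j = D i j.

(* The maximal space of a finite antipodal space with semi-metric rho is the
   set of antipodal functions Moebius equivalent to rho, i.e. of the functions
   exp ((u_i + u_j) / 2) rho_ij with u in the tight span of D = -2 log rho. *)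
Definition tight_span : set V := [set u | feasible u /\ forall i, tight_at u i].

(** The largest value of coordinate [i] that the other coordinates allow. [lift i ord0] is only the
    index different from [i] that the arg min asks for. *)
Definition slack i u : R :=
  let j := [arg min_(j < lift i ord0 | j != i) (D i j - u 0 j)]%O in
  D i j - u 0 j.

Definition raise i u : V := \row_j (if j == i then slack i u else u 0 j).

Definition sweep (s : seq 'I_k) u : V := foldr raise u s.

(** The first sweep makes an arbitrary vector feasible; the second starts from a feasible vector,
    only increases it, and makes every coordinate tight. *)
Definition retract u : V := sweep (enum 'I_k) (sweep (enum 'I_k) u).

Lemma slack_le i u j : j != i -> slack i u <= D i j - u 0 j.
Proof.
rewrite /slack; case: Order.TotalTheory.arg_minP => [|a ai h ji].
  by rewrite eq_sym neq_lift.
exact: h.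
Qed.

Lemma slack_attained i u : exists2 j, j != i & slack i u = D i j - u 0 j.
Proof.
rewrite /slack; case: Order.TotalTheory.arg_minP => [|a ai h].
  by rewrite eq_sym neq_lift.
by exists a.
Qed.

Lemma raise_id i u : raise i u 0 i = slack i u.
Proof. by rewrite mxE eqxx. Qed.

Lemma raise_neq i u j : j != i -> raise i u 0 j = u 0 j.
Proof. by rewrite mxE => /negbTE ->. Qed.

Lemma raise_lip i u v : `|raise i u - raise i v| <= `|u - v|.
Proof.
have half w w' : slack i w - slack i w' <= `|w - w'|.
  have [j ji ->] := slack_attained i w'.
  have := slack_le w ji; have := rV_dist_ge w w' j.
  rewrite ler_norml => /andP[]; lra.
apply/rV_distP => // j; have [->|ji] := eqVneq j i; last first.
  by rewrite !raise_neq// rV_dist_ge.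
rewrite !raise_id ler_norml half andbT lerNl opprB distrC; exact: half.
Qed.

Lemma sweep_lip s u v : `|sweep s u - sweep s v| <= `|u - v|.
Proof. by elim: s => //= i s IH; apply: le_trans IH; exact: raise_lip. Qed.

Lemma retract_lip u v : `|retract u - retract v| <= `|u - v|.
Proof. by rewrite (le_trans (sweep_lip _ _ _))// sweep_lip. Qed.

Hypothesis symD : forall i j, D i j = D j i.

(** Whichever of the two coordinates is raised last is set to a value that enforces the inequality,
    and no later raise touches either of them. *)
Lemma sweep_feasible_at s u i j : i \in s -> i != j ->
  sweep s u 0 i + sweep s u 0 j <= D i j.
Proof.
suff H a b : a \in s -> a != b -> sweep s u 0 a + sweep s u 0 b <= D a b.
  exact: H.
elim: s a b => //= c s IH a b; have sl e : e != c ->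
    raise c (sweep s u) 0 c + raise c (sweep s u) 0 e <= D c e.
  move=> ec; rewrite raise_id raise_neq//.
  by have := slack_le (sweep s u) ec; lra.
rewrite inE; have [-> _|ac /= as_] := eqVneq a c.
  by rewrite eq_sym; exact: sl.
have [-> _|bc ab] := eqVneq b c; first by rewrite addrC symD; exact: sl.
by rewrite !raise_neq//; exact: IH.
Qed.

Lemma sweep_feasible u : feasible (sweep (enum 'I_k) u).
Proof. by move=> i j; apply: sweep_feasible_at; rewrite mem_enum. Qed.

Lemma raise_ge i u j : feasible u -> u 0 j <= raise i u 0 j.
Proof.
move=> fu; have [->|ji] := eqVneq j i; last by rewrite raise_neq.
rewrite raise_id; have [l li ->] := slack_attained i u.
by have := fu i l; rewrite eq_sym => /(_ li); lra.
Qed.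

Lemma raise_feasible i u : feasible u -> feasible (raise i u).
Proof.
have H a b : a != b -> a = i -> raise i u 0 a + raise i u 0 b <= D a b.
  move=> ab ai; subst a; rewrite eq_sym in ab; rewrite raise_id raise_neq//.
  by have := slack_le u ab; lra.
move=> fu a b ab; have [ai|ai] := eqVneq a i; first exact: H.
have [bi|bi] := eqVneq b i.
  by rewrite addrC symD; apply: H => //; rewrite eq_sym.
by rewrite !raise_neq//; exact: fu.
Qed.

Lemma raise_tight i u : feasible u -> tight_at u i -> raise i u = u.
Proof.
move=> fu [j ji uij]; apply/rowP => a.
have [->|ai] := eqVneq a i; last by rewrite raise_neq.
apply/eqP; rewrite eq_le raise_ge// andbT raise_id.
by have := slack_le u ji; lra.
Qed.

Lemma raise_tight_at i u : tight_at (raise i u) i.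
Proof.
have [j ji e] := slack_attained i u; exists j => //.
by rewrite raise_id raise_neq// e; lra.
Qed.

(** Tightness at [a] could only be lost by raising its partner; but a partner of [a] is itself
    tight, so raising it changes nothing. *)
Lemma raise_keeps_tight i u a : feasible u -> tight_at u a ->
  tight_at (raise i u) a.
Proof.
move=> fu ta; have [->|ai] := eqVneq a i; first exact: raise_tight_at.
case: (ta) => j ja e; have [ji|ji] := eqVneq j i; last first.
  by exists j => //; rewrite !raise_neq.
subst j; rewrite raise_tight//; exists a; first by rewrite eq_sym.
by rewrite addrC symD.
Qed.

Lemma sweep_span s u : feasible u -> [/\ feasible (sweep s u),
  forall i, u 0 i <= sweep s u 0 i & forall i, i \in s -> tight_at (sweep s u) i].
Proof.
move=> fu; elim: s => //= c s [f1 g1 t1]; split; first exact: raise_feasible.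
  by move=> i; apply: le_trans (g1 i) _; exact: raise_ge.
move=> i; rewrite inE => /predU1P[->|/t1]; first exact: raise_tight_at.
exact: raise_keeps_tight.
Qed.

Lemma retract_span u : tight_span (retract u).
Proof.
have [f1 _ t1] := sweep_span (enum 'I_k) (sweep_feasible u).
by split=> // i; apply: t1; rewrite mem_enum.
Qed.

Lemma sweep_fix s u : tight_span u -> sweep s u = u.
Proof. by move=> [fu tu]; elim: s => //= i s ->; exact: raise_tight. Qed.

Lemma retract_fix u : tight_span u -> retract u = u.
Proof. by move=> uT; rewrite /retract !sweep_fix. Qed.

Lemma retract_ge u i : feasible u -> u 0 i <= retract u 0 i.
Proof.
move=> fu; have [f1 g1 _] := sweep_span (enum 'I_k) fu.
have [_ g2 _] := sweep_span (enum 'I_k) f1.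
exact: le_trans (g1 i) (g2 i).
Qed.

Lemma retract_dist u v : tight_span v -> `|retract u - v| <= `|u - v|.
Proof. by move=> vT; rewrite -[in leLHS](retract_fix vT) retract_lip. Qed.

(* A vector satisfying the conditions up to [a] is [3/2 a]-close to a point of
   the span, namely the projection of its translate by [- a / 2]. *)
Lemma retract_near u (a : R) : 0 <= a ->
  (forall i j, i != j -> u 0 i + u 0 j <= D i j + a) ->
  (forall i, exists2 j, j != i & D i j - a <= u 0 i + u 0 j) ->
  `|retract u - u| <= 3 * a.
Proof.
move=> a0 fu tu; pose w := u - const_mx (a / 2).
have wE i : w 0 i = u 0 i - a / 2 by rewrite !mxE.
have fw : feasible w by move=> i j /fu; rewrite !wE; lra.
have mu : `|u - retract w| <= 3 / 2 * a.
  apply/rV_distP => [|i]; first by lra.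
  have [j ji tj] := tu i; have := retract_ge i fw; have := retract_ge j fw.
  have := (retract_span w).1 i j; rewrite eq_sym => /(_ ji).
  by rewrite !wE ler_norml => h1 h2 h3; apply/andP; split; lra.
(* [retract] is 1-Lipschitz and fixes [retract w], so [retract u] is as close to [retract w] as [u]
   is: twice [3 / 2 * a] in total. *)
have := ler_distD (retract w) (retract u) u.
have := retract_dist u (retract_span w); rewrite (distrC (retract w)); lra.
Qed.

(** The norm is attained with both signs: if [v - u] is largest at [i] and [j] is a partner of [i]
    for [u], feasibility of [v] forces [v] to drop by the same amount at [j]. Thus [i] is an end in
    the direction from [u] to [v], and [j] one in the opposite direction. *)
Lemma span_dist_attained u v : tight_span u -> tight_span v ->
  exists i j, [/\ j != i, v 0 i - u 0 i = `|v - u|,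
    u 0 j - v 0 j = `|v - u|, u 0 i + u 0 j = D i j & v 0 i + v 0 j = D i j].
Proof.
move=> uT vT.
have main i : v 0 i - u 0 i = `|v - u| -> exists i j, [/\ j != i,
    v 0 i - u 0 i = `|v - u|, u 0 j - v 0 j = `|v - u|,
    u 0 i + u 0 j = D i j & v 0 i + v 0 j = D i j].
  move=> vui; have [j ji uij] := uT.2 i; exists i, j.
  have := vT.1 i j; rewrite eq_sym => /(_ ji) vij.
  have := rV_dist_ge v u j; rewrite ler_norml => /andP[h1 h2].
  by split => //; lra.
have [i] := rV_norm_attained (v - u); rewrite !mxE => vui.
have [h|h] := leP 0 (v 0 i - u 0 i).
  by apply: (main i); rewrite vui ger0_norm.
have [j ji vij] := vT.2 i; have := uT.1 i j; rewrite eq_sym => /(_ ji) uij.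
have := rV_dist_ge v u j; rewrite ler_norml => /andP[h1 h2].
by apply: (main j); move: vui; rewrite ltr0_norm// => ?; lra.
Qed.

Definition span_ray u i (t : R) : V :=
  retract (\row_j (if j == i then u 0 i + t else u 0 j - t)).

Lemma span_ray_span u i t : tight_span (span_ray u i t).
Proof. exact: retract_span. Qed.

Lemma span_ray_lip u i s t : `|span_ray u i s - span_ray u i t| <= `|s - t|.
Proof.
apply: le_trans (retract_lip _ _) _; apply/rV_distP => // j.
rewrite !mxE; case: (j == i).
  by rewrite (_ : _ - _ = s - t)//; lra.
by rewrite (_ : _ - _ = t - s) 1?distrC//; lra.
Qed.

Lemma span_ray0 u i : tight_span u -> span_ray u i 0 = u.
Proof.
move=> uT; rewrite /span_ray -[RHS](retract_fix uT); congr retract.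
by apply/rowP => j; rewrite !mxE; case: eqP => [->|_]; lra.
Qed.

(** The vector before retraction is feasible and still satisfies with equality the condition of a
    partner [j] of [i]. Retraction can only increase coordinates [i] and [j], and their sum is
    already maximal. *)
Lemma span_ray_coord u i t : tight_span u -> 0 <= t -> span_ray u i t 0 i = u 0 i + t.
Proof.
move=> [fu tu] t0; set w : V := \row_j (if j == i then u 0 i + t else u 0 j - t).
have wi : w 0 i = u 0 i + t by rewrite mxE eqxx.
have wN j : j != i -> w 0 j = u 0 j - t by rewrite mxE => /negbTE ->.
have fw : feasible w.
  move=> a b ab; have := fu a b ab; move: ab.
  have [->|ai] := eqVneq a i; have [->|bi] := eqVneq b i => // _.
  - by rewrite wi (wN b)//; lra.
  - by rewrite wi (wN a)//; lra.
  - by rewrite !wN//; lra.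
have [j ji e] := tu i.
have := retract_ge i fw; have := retract_ge j fw; rewrite wi (wN j)// => h1 h2.
have := (span_ray_span u i t).1 i j; rewrite eq_sym => /(_ ji).
by rewrite /span_ray -/w; lra.
Qed.

Lemma span_ray_dist u i s t : tight_span u -> 0 <= s -> 0 <= t ->
  `|span_ray u i s - span_ray u i t| = `|s - t|.
Proof.
move=> uT s0 t0; apply/eqP; rewrite eq_le span_ray_lip/=.
have := rV_dist_ge (span_ray u i s) (span_ray u i t) i; rewrite !span_ray_coord//.
by rewrite (_ : _ - _ = s - t)//; lra.
Qed.

Lemma feasible0_ge0 : feasible 0 -> forall i j, i != j -> 0 <= D i j.
Proof. by move=> f0 i j /f0; rewrite !mxE addr0. Qed.

Lemma upper_bound_ex : exists2 K : R, 0 <= K & forall i j, D i j <= K.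
Proof.
pose K := \big[Num.max/0]_(p : 'I_k * 'I_k) D p.1 p.2.
exists K => [|i j]; first exact: bigmax_ge_id.
exact: (le_bigmax _ (fun p : 'I_k * 'I_k => D p.1 p.2) (i, j)).
Qed.

End TightSpan.

(** * Points far out in the ends of the span *)

Section FarPoints.
Context {R : realType} {n : nat}.
Notation k := n.+2.
Notation V := 'rV[R]_k.
Variables (D : 'I_k -> 'I_k -> R) (K : R).
Hypothesis symD : forall i j, D i j = D j i.
Hypothesis feas0 : feasible D 0.
Hypothesis DK : forall i j, D i j <= K.
Implicit Types (u v w y z : V) (i j l : 'I_k).

(** All coordinates other than [i] are negative, so two of them cannot add up to an entry of [D],
    which is nonnegative: the partner of [j] must be [i]. *)
Lemma far_coord y i j : tight_span D y -> K < y 0 i -> j != i ->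
  y 0 j = D i j - y 0 i.
Proof.
move=> [fy ty] Ky ji; have [l lj e] := ty j.
have [li|li] := eqVneq l i; first by move: e; rewrite li symD; lra.
have := fy j i ji; have := fy l i li.
have := DK j i; have := DK l i.
have := feasible0_ge0 feas0 (_ : j != l); rewrite eq_sym => /(_ lj); lra.
Qed.

(** Every coordinate of [y] other than [i] lies below [- |z|], so [y - z] can reach its norm with
    positive sign only at [i]. *)
Lemma far_dist y z i : tight_span D y -> tight_span D z -> K + `|z| < y 0 i ->
  `|y - z| = y 0 i - z 0 i.
Proof.
move=> yT zT yi; have [l [_ [_ e _ _ _]]] := span_dist_attained zT yT.
have [li|li] := eqVneq l i; first by rewrite -e li.
have := yT.1 l i li; have := DK l i; have := normr_ge0 (y - z).
have := rV_norm_ge z l; rewrite ler_norml => /andP[]; lra.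
Qed.

Lemma far_dist_same y z i : tight_span D y -> tight_span D z ->
  K < y 0 i -> K < z 0 i -> `|y - z| = `|y 0 i - z 0 i|.
Proof.
move=> yT zT yi zi; apply/eqP; rewrite eq_le rV_dist_ge andbT.
apply/rV_distP => // j; have [->//|ji] := eqVneq j i.
rewrite (far_coord yT yi ji) (far_coord zT zi ji) distrC.
by rewrite (_ : _ - _ = y 0 i - z 0 i)//; lra.
Qed.

Lemma far_dist_diff y z i j : tight_span D y -> tight_span D z -> i != j ->
  K < y 0 i -> K < z 0 j -> `|y - z| = y 0 i + z 0 j - D i j.
Proof.
move=> yT zT ij yi zj; have zi := far_coord zT zj ij.
have [l [_ [_ e _ _ _]]] := span_dist_attained zT yT.
have := rV_dist_ge y z i; rewrite ler_norml => /andP[_ h].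
have [li|li] := eqVneq l i; first by rewrite -e li zi symD; lra.
have yl := far_coord yT yi li; have Dii := DK i l; have Dij := DK i j.
have D0 := feasible0_ge0 feas0.
have [lj|lj] := eqVneq l j.
  have := D0 i j ij; rewrite lj in e yl; move: h; rewrite zi symD; lra.
have := D0 j l (_ : j != l); rewrite eq_sym => /(_ lj).
have zl := far_coord zT zj lj; move: h; rewrite zi (symD j i); lra.
Qed.

End FarPoints.

(** * The tight span as a metric space *)

Definition tspace {R : realType} {n : nat} (D : 'I_n.+2 -> 'I_n.+2 -> R) :=
  {u : 'rV[R]_n.+2 | tight_span D u}.

Section TSpaceMetric.
Context {R : realType} {n : nat} (D : 'I_n.+2 -> 'I_n.+2 -> R).
Notation M := (tspace D).

HB.instance Definition _ := gen_eqMixin M.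
HB.instance Definition _ := gen_choiceMixin M.

Let dist (x y : M) : R := `|sval x - sval y|.

Let distxx x : dist x x = 0. Proof. by rewrite /dist subrr normr0. Qed.

Let dist_eq0 x y : dist x y = 0 -> x = y.
Proof.
move=> /eqP; rewrite normr_eq0 subr_eq0 => /eqP.
exact: eq_sig_hprop.
Qed.

Let dist_sym x y : dist x y = dist y x. Proof. exact: distrC. Qed.

Let dist_triangle y x z : dist x z <= dist x y + dist y z.
Proof. exact: ler_distD. Qed.

HB.instance Definition _ :=
  @isMetric.Build R M dist distxx dist_eq0 dist_sym dist_triangle.

Lemma tspace_mdistE (x y : M) : mdist x y = `|sval x - sval y|.
Proof. by []. Qed.

End TSpaceMetric.

Section MetricGeneralities.
Context {R : realType} {X : metricType R}.
Implicit Types (w x y z o : X) (c : R -> X).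

Lemma isometric_on_lip (a b : R) c : mdist (c a) (c b) = b - a ->
  (forall s t, a <= s -> s <= t -> t <= b -> mdist (c s) (c t) <= t - s) ->
  isometric_on `[a, b] c.
Proof.
move=> ab lip.
suff H s t : a <= s -> s <= t -> t <= b -> mdist (c s) (c t) = t - s.
  move=> s t /=; rewrite !in_itv/= => /andP[as_ sb] /andP[at_ tb].
  have [st|ts] := leP s t; first by rewrite H// distrC ger0_norm ?subr_ge0.
  by rewrite metric_sym H// ?(ltW ts)// ger0_norm// subr_ge0 ltW.
move=> as_ st tb; apply/eqP; rewrite eq_le lip//=.
have := metric_triangle (c a) (c s) (c b); have := metric_triangle (c s) (c t) (c b).
have := lip a s (lexx _) as_ (le_trans st tb).
by have := lip t b (le_trans as_ st) tb (lexx _); lra.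
Qed.

Lemma gromov_product_sym o x y : gromov_product o x y = gromov_product o y x.
Proof. by rewrite /gromov_product (metric_sym x y) (addrC (mdist x o)). Qed.

Lemma gromov_product_ge0 o x y : 0 <= gromov_product o x y.
Proof.
rewrite /gromov_product divr_ge0// subr_ge0 (metric_sym y o).
exact: metric_triangle.
Qed.

Lemma gromov_product_le o x y : gromov_product o x y <= mdist x o.
Proof.
rewrite /gromov_product.
by have := metric_triangle y x o; rewrite (metric_sym y x); lra.
Qed.

Lemma gromov_product_lip o y z y' z' :
  `|gromov_product o y z - gromov_product o y' z'| <= mdist y y' + mdist z z'.
Proof.
rewrite /gromov_product ler_norml; have := metric_triangle y y' o.
have := metric_triangle y' y o; have := metric_triangle z z' o.
have := metric_triangle z' z o; have := metric_triangle y y' z.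
have := metric_triangle y' z' z; have := metric_triangle y' y z'.
have := metric_triangle y z z'; rewrite (metric_sym y' y) (metric_sym z' z).
by move=> *; apply/andP; split; lra.
Qed.

(* Passing to an arbitrary base point doubles the constant. *)
Lemma gromov_hyperbolic_base w (delta : R) :
  (forall x y z, Num.min (gromov_product w x y) (gromov_product w y z) - delta
     <= gromov_product w x z) ->
  gromov_hyperbolic X.
Proof.
move=> H; exists (2 * delta) => o x y z.
have := H x y z; have := H x o z; have := H o x y; have := H o z y.
rewrite /gromov_product (metric_sym z y) (metric_sym x o).
rewrite (metric_sym z o) (metric_sym y o).
by rewrite !minEle; do 5 (case: ifPn; rewrite -?ltNge => ?); lra.
Qed.

End MetricGeneralities.

(** * Properness, geodesics and hyperbolicity of the span *)

Section TSpaceGood.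
Context {R : realType} {n : nat}.
Variable D : 'I_n.+2 -> 'I_n.+2 -> R.
Notation k := n.+2.
Notation V := 'rV[R]_k.
Notation M := (tspace D).
Hypothesis symD : forall i j, D i j = D j i.
Hypothesis span0 : tight_span D 0.
Implicit Types (x y z o : M) (u v : V) (i j l : 'I_k).

Definition retract_pt u : M := exist _ (retract D u) (retract_span symD u).

Definition ray_pt x i (t : R) : M :=
  exist _ (span_ray D (sval x) i t) (span_ray_span symD _ i t).

Definition origin : M := exist _ 0 span0.

Lemma retract_pt_fix x : retract_pt (sval x) = x.
Proof. by apply: eq_sig_hprop => //=; exact: retract_fix (svalP x). Qed.

Lemma retract_pt_lip u v : mdist (retract_pt u) (retract_pt v) <= `|u - v|.
Proof. exact: retract_lip. Qed.

Lemma retract_pt_continuous : continuous retract_pt.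
Proof.
move=> u A /nbhs_ballP[e /= e0 eA]; rewrite nbhs_simpl/=; apply/nbhs_ballP.
exists e => //= v; rewrite -ball_normE/= => uv; apply: eA; rewrite ballEmdist/=.
exact: le_lt_trans (retract_pt_lip _ _) uv.
Qed.

Lemma tspace_proper : proper_space M.
Proof.
move=> x r; have -> : cball x r = retract_pt @` closed_ball_ Num.norm (sval x) r.
  apply/seteqP; split=> [y|_ [u /= ur <-]].
    by move=> xyr; exists (sval y); rewrite ?retract_pt_fix.
  apply: le_trans ur; rewrite -[in leLHS](retract_pt_fix x); exact: retract_pt_lip.
apply: continuous_compact.
  by apply: continuous_subspaceT; exact: retract_pt_continuous.
apply: bounded_closed_compact; last exact: closed_closed_ball_.
exists (`|sval x| + r); split; first exact: num_real.
move=> a xa u; rewrite /closed_ball_/= => ur; apply: le_trans (ltW xa).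
have := ler_normB (sval x) (sval x - u); rewrite subKr; lra.
Qed.

Lemma tspace_geodesic : geodesic_space M.
Proof.
move=> x y; set d := mdist x y.
pose c t := retract_pt (sval x + (t / d) *: (sval y - sval x)).
have c0 : c 0 = x by rewrite /c mul0r scale0r addr0 retract_pt_fix.
have cd : c d = y.
  have [d0|d0] := eqVneq d 0; first by rewrite d0 c0; exact: mdist_positivity.
  by rewrite /c divff// scale1r addrC subrK retract_pt_fix.
exists c; split => //; apply: isometric_on_lip; rewrite ?c0 ?cd ?subr0//.
move=> s t _ st _; apply: le_trans (retract_pt_lip _ _) _.
rewrite opprD addrACA subrr add0r -scalerBl normrZ -mulrBl normrM.
rewrite -(tspace_mdistE y x) (metric_sym y) -/d distrC.
have [->|d0] := eqVneq d 0; first by rewrite mulr0 subr_ge0.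
by rewrite normfV (ger0_norm (mdist_ge0 x y)) mulfVK// ger0_norm ?subr_ge0.
Qed.

(** With [i] and [j] the two ends given by [span_dist_attained], the segment is prolonged by the ray
    towards [i] after [b] and towards [j] before [a]. The result is 1-Lipschitz piece by piece, and
    its coordinate [i] grows at unit speed throughout, which bounds distances from below. *)
Lemma tspace_geodesically_complete : geodesically_complete M.
Proof.
move=> a b c ab ciso.
have inab t : a <= t -> t <= b -> t \in `[a, b] by rewrite in_itv/= => -> ->.
have cE s t : a <= s -> s <= t -> t <= b -> mdist (c s) (c t) = t - s.
  move=> as_ st tb; rewrite ciso//=; last 2 first.
  - by apply: inab => //; exact: le_trans tb.
  - by apply: inab => //; exact: le_trans st.
  by rewrite distrC ger0_norm// subr_ge0.
set x := c a; set y := c b.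
have [i [j [ji]]] := span_dist_attained (svalP x) (svalP y).
rewrite -(tspace_mdistE y x) metric_sym cE// => yi xj xij yij.
pose c' t := if t < a then ray_pt x j (a - t) else
             if t <= b then c t else ray_pt y i (t - b).
have c'b t : b <= t -> c' t = ray_pt y i (t - b).
  move=> bt; rewrite /c'; case: ltP => [ta|_].
    by have := lt_le_trans ta ab; rewrite ltNge bt.
  case: ltgtP bt => // <- _; rewrite subrr; apply: eq_sig_hprop => //=.
  by rewrite span_ray0//; exact: svalP.
have c'a t : t <= a -> c' t = ray_pt x j (a - t).
  move=> ta; rewrite /c'; case: ltgtP ta => // -> _.
  rewrite ab subrr; apply: eq_sig_hprop => //=.
  by rewrite span_ray0//; exact: svalP.
have c'c t : a <= t -> t <= b -> c' t = c t.
  by rewrite /c' => at_ ->; rewrite ltNge at_.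
have x0 (s t : R) : s <= t -> `|s - t| = t - s.
  by move=> st; rewrite distrC ger0_norm// subr_ge0.
have lip s t : s <= t -> mdist (c' s) (c' t) <= t - s.
  have lipa p q : p <= q -> q <= a -> mdist (c' p) (c' q) <= q - p.
    move=> pq qa; rewrite !c'a// ?(le_trans pq)//.
    apply: le_trans (span_ray_lip _ _ _ _ _) _.
    by rewrite (_ : _ - _ = q - p) ?ger0_norm ?subr_ge0//; lra.
  have lipb p q : p <= q -> b <= p -> mdist (c' p) (c' q) <= q - p.
    move=> pq bp; rewrite !c'b// ?(le_trans bp)//.
    apply: le_trans (span_ray_lip _ _ _ _ _) _.
    by rewrite (_ : _ - _ = p - q) ?x0//; lra.
  have lipc p q : a <= p -> p <= q -> q <= b -> mdist (c' p) (c' q) <= q - p.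
    by move=> ap pq qb; rewrite !c'c ?cE// ?(le_trans ap)// (le_trans pq).
  have lipab p q : p <= q -> q <= b -> mdist (c' p) (c' q) <= q - p.
    move=> pq qb; have [qa|aq] := leP q a; first exact: lipa.
    have [pa|ap] := leP p a; last exact: lipc (ltW ap) pq qb.
    have := metric_triangle (c' p) (c' a) (c' q).
    have := lipa p a pa (lexx _); have := lipc a q (lexx _) (ltW aq) qb; lra.
  move=> st; have [tb|bt] := leP t b; first exact: lipab.
  have [sb|bs] := leP s b; last exact: lipb st (ltW bs).
  have := metric_triangle (c' s) (c' b) (c' t).
  have := lipab s b sb (lexx _); have := lipb b t (ltW bt) (lexx _); lra.
(* On the backward ray coordinate [j] is the one known exactly. Feasibility of the pair, together
   with [x_i + x_j = D_ij], bounds coordinate [i] from above, and the Lipschitz estimate bounds it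
   from below. *)
have coord t : sval (c' t) 0 i = sval x 0 i + (t - a).
  have [ta|at_] := leP t a.
    have h1 : sval (c' t) 0 j = sval x 0 j + (a - t).
      by rewrite c'a//= span_ray_coord ?subr_ge0//; exact: svalP.
    have := (svalP (c' t)).1 j i ji; rewrite h1 (symD j).
    have := lip t a ta; rewrite (c'c a)// -/x => h2.
    by have := le_trans (rV_dist_ge _ _ i) h2; rewrite ler_norml => /andP[]; lra.
  have [tb|bt] := leP t b; last first.
    by rewrite c'b ?ltW//= span_ray_coord ?subr_ge0 ?(ltW bt)//; [lra|exact: svalP].
  have := lip a t (ltW at_); have := lip t b tb.
  rewrite (c'c a) ?(c'c b)// -/x -/y => h2 h3.
  have := le_trans (rV_dist_ge _ _ i) h2; have := le_trans (rV_dist_ge _ _ i) h3.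
  by rewrite !ler_norml => /andP[? ?] /andP[? ?]; lra.
exists c' => [s t _ _|t]; last by rewrite in_itv/= => /andP[]; exact: c'c.
apply/eqP; rewrite eq_le; apply/andP; split.
  have [st|ts] := leP s t; first by rewrite x0// lip.
  by rewrite metric_sym distrC (x0 _ _ (ltW ts)); apply: lip; exact: ltW.
have := rV_dist_ge (sval (c' s)) (sval (c' t)) i; rewrite !coord.
by rewrite (_ : _ - _ = s - t)//; lra.
Qed.

(** Seen from the origin, a Gromov product above [K] forces both points into the same end, where the
    product is the minimum of two coordinates, as in a tree. A product of at most [K] is absorbed by
    the constant because products are nonnegative. *)
Lemma tspace_hyperbolic : gromov_hyperbolic M.
Proof.
have [K K0 DK] := upper_bound_ex D; have f0 := span0.1.
apply: (gromov_hyperbolic_base (w := origin) (delta := K)) => x y z.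
have d0 (p : M) : mdist p origin = `|sval p| by rewrite tspace_mdistE/= subr0.
have large p : K < mdist p origin ->
    exists i, K < sval p 0 i /\ mdist p origin = sval p 0 i.
  move=> Kp; have [i [_ [_ + _ _ _]]] := span_dist_attained span0 (svalP p).
  by rewrite mxE !subr0 -d0 => e; exists i; rewrite e.
have same (p q : M) i : K < sval p 0 i -> mdist p origin = sval p 0 i ->
    K < sval q 0 i -> mdist q origin = sval q 0 i ->
    gromov_product origin p q = Num.min (sval p 0 i) (sval q 0 i).
  move=> pi ei qi fi; rewrite /gromov_product ei fi tspace_mdistE.
  rewrite (far_dist_same symD f0 DK (svalP p) (svalP q) pi qi).
  have [h|h] := leP (sval p 0 i) (sval q 0 i); last first.
    by rewrite ger0_norm ?subr_ge0 ?(ltW h)//; lra.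
  by rewrite distrC ger0_norm ?subr_ge0//; lra.
have ends (p q : M) : K < gromov_product origin p q -> exists i,
    [/\ K < sval p 0 i, mdist p origin = sval p 0 i,
        K < sval q 0 i & mdist q origin = sval q 0 i].
  move=> Kpq; have [i [pi ei]] := large p (lt_le_trans Kpq (gromov_product_le _ _ _)).
  have [] := large q; last move=> j [qj ej].
    by apply: lt_le_trans Kpq _; rewrite gromov_product_sym gromov_product_le.
  have [ij|ij] := eqVneq i j; first by exists i; rewrite {3 4}ij.
  move: Kpq; rewrite /gromov_product (tspace_mdistE p q).
  rewrite (far_dist_diff symD f0 DK (svalP p) (svalP q) ij pi qj) ei ej.
  by have := DK i j; lra.
rewrite lerBlDr.
have [h1|/ends[i [x1 x2 y1 y2]]] := leP (gromov_product origin x y) K.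
  rewrite ge_min; apply/orP; left.
  by have := gromov_product_ge0 origin x z; lra.
have [h1|/ends[j [y3 y4 z3 z4]]] := leP (gromov_product origin y z) K.
  rewrite ge_min; apply/orP; right.
  by have := gromov_product_ge0 origin x z; lra.
have ij : i = j.
  apply/eqP/negPn/negP => ij; have := (svalP y).1 i j ij; have := DK i j; lra.
subst j; rewrite !(same _ _ i)// -lerBlDr; apply: le_trans (_ : _ - 0 <= _).
  by rewrite lerB.
rewrite subr0 le_min !ge_min !lexx !orbT//.
Qed.

End TSpaceGood.

(** * Boundaries of good hyperbolic spaces *)

Section Boundary.
Context {R : realType} {X : metricType R}.
Implicit Types (x y z o : X) (c : R -> X) (xi eta : boundary X).

Lemma asymptotic_sym c c' : asymptotic c c' -> asymptotic c' c.
Proof. by move=> [C H]; exists C => t t0; rewrite metric_sym H. Qed.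

Lemma asymptotic_trans c' c c'' :
  asymptotic c c' -> asymptotic c' c'' -> asymptotic c c''.
Proof.
move=> [C H] [C' H']; exists (C + C') => t t0.
exact: le_trans (metric_triangle _ (c' t) _) (lerD (H _ t0) (H' _ t0)).
Qed.

Definition endpoint c (cr : is_ray c) : boundary X :=
  exist _ (ray_class c) (ex_intro2 _ _ c cr erefl).

Lemma endpointP c (cr : is_ray c) : sval (endpoint cr) c.
Proof. by split=> //; exists 0 => t t0; rewrite mdistxx. Qed.

Lemma boundary_ray xi c : sval xi c -> is_ray c.
Proof. by case: xi => S /= [c0 _ ->] []. Qed.

Lemma boundary_ex_ray xi : exists c, sval xi c.
Proof.
case: xi => S /= [c0 c0r ->]; exists c0.
by have := endpointP c0r.
Qed.

Lemma boundary_asymptotic xi c c' : sval xi c -> sval xi c' -> asymptotic c c'.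
Proof.
case: xi => S /= [c0 _ ->] [_ /asymptotic_sym h] [_ h'].
exact: asymptotic_trans h h'.
Qed.

Lemma boundary_eq xi eta c c' : sval xi c -> sval eta c' -> asymptotic c c' ->
  xi = eta.
Proof.
move=> xic etac cc'; apply: eq_sig_hprop => [S|]; first exact: Prop_irrelevance.
suff H (xi1 xi2 : boundary X) c1 c2 : sval xi1 c1 -> sval xi2 c2 ->
    asymptotic c1 c2 -> sval xi1 `<=` sval xi2.
  by apply/seteqP; split; [exact: H cc'|apply: H (asymptotic_sym cc')].
move=> h1 h2 h12 d h; have dr := boundary_ray h.
have d2 := asymptotic_trans (boundary_asymptotic h h1) h12.
case: xi2 h2 => S /= [c0 _ ->] [_ h0]; split => //.
exact: asymptotic_trans h0 (asymptotic_sym d2).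
Qed.

Lemma ray_dist c s t : is_ray c -> 0 <= s -> s <= t -> mdist (c s) (c t) = t - s.
Proof.
move=> cr s0 st; rewrite cr//=; last exact: le_trans st.
by rewrite distrC ger0_norm// subr_ge0.
Qed.

Lemma ray_cvg xi c : sval xi c ->
  (inl (c t) : bordification X) @[t --> +oo] --> (inr xi : bordification X).
Proof.
move=> xic; have cr := boundary_ray xic; move=> A; rewrite nbhsE => -[U [Uo Uxi] UA].
have [r rU] := Uo.2 xi Uxi (c 0).
exists (Num.max 0 r); split; first exact: num_real.
move=> t; rewrite gt_max => /andP[t0 rt]; apply: UA; apply: rU.
exists c => //; exists t => s ts; rewrite /gromov_product.
rewrite (metric_sym (c t)) (metric_sym (c s)) !ray_dist ?(ltW t0)//; last first.
  by apply: le_trans ts; exact: ltW.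
lra.
Qed.

End Boundary.

(** * Gromov products and Busemann functions at infinity *)

Section GromovExtension.
Context {R : realType} {X : metricType R}.
Hypothesis bcX : boundary_continuous X.
Implicit Types (x y z o : X) (c : R -> X) (xi eta : boundary X).

Lemma ext_gromov_productP x :
  continuous_gromov_extension x (ext_gromov_product (X := X) x).
Proof.
have [G xG] := bcX x.
exact: (@xgetPex _ (fun=> 0%E) [set G | continuous_gromov_extension x G]
  (ex_intro _ G xG)).
Qed.

Lemma ext_continuous x (T : Type) (F : set_system T) (FF : Filter F)
    (u v : T -> bordification X) (a b : bordification X) :
  u t @[t --> F] --> a -> v t @[t --> F] --> b ->
  ext_gromov_product x (u t, v t) @[t --> F] --> ext_gromov_product x (a, b).
Proof.
move=> ua vb; have [Gc _] := ext_gromov_productP x.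
apply: (cvg_comp (fun t => (u t, v t)) _ _ (Gc (a, b))).
exact: (cvg_pair (G := nbhs a) (H := nbhs b) ua vb).
Qed.

Lemma ext_rays_cvg x xi eta c c' : sval xi c -> sval eta c' ->
  (gromov_product x (c t) (c' t))%:E @[t --> +oo] -->
    ext_gromov_product x (inr xi, inr eta).
Proof.
move=> xic etac; have [_ GE] := ext_gromov_productP x.
under eq_cvg do rewrite -GE.
by apply: ext_continuous; exact: ray_cvg.
Qed.

Lemma ext_ray_cvg x y xi c : sval xi c ->
  (gromov_product x (c t) y)%:E @[t --> +oo] -->
    ext_gromov_product x (inr xi, inl y).
Proof.
move=> xic; have [_ GE] := ext_gromov_productP x.
under eq_cvg do rewrite -GE.
by apply: ext_continuous; [exact: ray_cvg|exact: cvg_cst].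
Qed.

Lemma ext_ray_ge0_le x y xi :
  (0 <= ext_gromov_product x (inr xi, inl y) <= (mdist x y)%:E)%E.
Proof.
have [c xic] := boundary_ex_ray xi; have h := ext_ray_cvg (x := x) (y := y) xic.
apply/andP; split.
  apply: (closed_cvg _ (@closed_ereal_le_ereal R 0%E) _ _ h).
  by near=> t; rewrite /= lee_fin gromov_product_ge0.
apply: (closed_cvg _ (@closed_ereal_ge_ereal R (mdist x y)%:E) _ _ h).
near=> t; rewrite /= lee_fin gromov_product_sym metric_sym.
exact: gromov_product_le.
Unshelve. all: by end_near. Qed.

Lemma ext_rays_ge0 x xi eta : (0 <= ext_gromov_product x (inr xi, inr eta))%E.
Proof.
have [c xic] := boundary_ex_ray xi; have [c' etac] := boundary_ex_ray eta.
apply: (closed_cvg _ (@closed_ereal_le_ereal R 0%E) _ _ (ext_rays_cvg (x := x) xic etac)).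
by near=> t; rewrite /= lee_fin gromov_product_ge0.
Unshelve. all: by end_near. Qed.

Lemma ext_rays_sym x xi eta :
  ext_gromov_product x (inr xi, inr eta) = ext_gromov_product x (inr eta, inr xi).
Proof.
have [c xic] := boundary_ex_ray xi; have [c' etac] := boundary_ex_ray eta.
apply: (cvg_unique (@ereal_hausdorff R) (ext_rays_cvg (x := x) xic etac)).
have := ext_rays_cvg (x := x) etac xic.
by under eq_cvg do rewrite gromov_product_sym.
Qed.

Lemma ext_rays_diag x xi : ext_gromov_product x (inr xi, inr xi) = +oo%E.
Proof.
have [c xic] := boundary_ex_ray xi; have cr := boundary_ray xic.
apply: (cvg_unique (@ereal_hausdorff R) (ext_rays_cvg (x := x) xic xic)).
apply/cvgeyPge => A; near=> t; rewrite lee_fin /gromov_product mdistxx.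
have t0 : 0 <= t by near: t; exact: nbhs_pinfty_ge.
have := metric_triangle (c 0) x (c t); rewrite ray_dist// (metric_sym x).
have : A + mdist (c 0) x <= t by near: t; apply: nbhs_pinfty_ge; exact: num_real.
by lra.
Unshelve. all: by end_near. Qed.

(** Limit of [d(x, c t) - d(y, c t)] along any ray [c] to [xi], so it is positive when [y] is closer
    to [xi]. Expressing it through the extended product avoids choosing a ray. *)
Definition busemann x y xi : R :=
  2 * fine (ext_gromov_product x (inr xi, inl y)) - mdist x y.

Lemma busemann_cvg x y xi c : sval xi c ->
  mdist x (c t) - mdist y (c t) @[t --> +oo] --> busemann x y xi.
Proof.
move=> xic; have h := ext_ray_cvg (x := x) (y := y) xic.
have /andP[h0 h1] := ext_ray_ge0_le x y xi.
have fin : ext_gromov_product x (inr xi, inl y) \is a fin_num.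
  by rewrite fin_numElt (lt_le_trans _ h0) ?ltNy0// (le_lt_trans h1) ?ltry.
move: h; rewrite -(fineK fin) => /fine_cvg/= h.
have -> : (fun t => mdist x (c t) - mdist y (c t)) =
   (fun t => 2 * gromov_product x (c t) y - mdist x y).
  apply/funext => t; rewrite /gromov_product (metric_sym x (c t)).
  rewrite (metric_sym y (c t)) (metric_sym y x); lra.
by apply: cvgB; [apply: cvgM; [exact: cvg_cst|exact: h]|exact: cvg_cst].
Qed.

Lemma busemann_cocycle x y z xi :
  busemann x z xi = busemann x y xi + busemann y z xi.
Proof.
have [c xic] := boundary_ex_ray xi.
apply: (cvg_unique (@Rhausdorff R) (busemann_cvg (x := x) (y := z) xic)).
have -> : (fun t => mdist x (c t) - mdist z (c t)) = (fun t =>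
    (mdist x (c t) - mdist y (c t)) + (mdist y (c t) - mdist z (c t))).
  by apply/funext => t; lra.
by apply: cvgD; exact: busemann_cvg.
Qed.

Lemma busemann_xx x xi : busemann x x xi = 0.
Proof. by have := busemann_cocycle x x x xi; lra. Qed.

Lemma busemann_le x y xi : `|busemann x y xi| <= mdist x y.
Proof.
have [c xic] := boundary_ex_ray xi; have := busemann_cvg (x := x) (y := y) xic.
have cl : closed [set a : R | `|a| <= mdist x y].
  have := @closed_closed_ball_ R R 0 (mdist x y).
  by congr closed; apply/seteqP; split=> a; rewrite /closed_ball_/= sub0r normrN.
move=> h; apply: (closed_cvg _ cl _ _ h); near=> t => /=.
rewrite ler_norml; have := metric_triangle x y (c t).
by have := metric_triangle y x (c t); rewrite (metric_sym y x); lra.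
Unshelve. all: by end_near. Qed.

End GromovExtension.

Section GoodBoundary.
Context {R : realType} {X : metricType R}.
Hypothesis goodX : good_hyperbolic X.
Implicit Types (x y z o : X) (c : R -> X) (xi eta : boundary X).

Let bcX : boundary_continuous X. Proof. by case: goodX => _ []. Qed.

(* Rays with unbounded Gromov products are asymptotic. *)
Lemma ext_rays_fin x xi eta : xi != eta ->
  ext_gromov_product x (inr xi, inr eta) \is a fin_num.
Proof.
move=> /eqP xe; rewrite ge0_fin_numE; last exact: ext_rays_ge0.
rewrite ltey; apply/eqP => Goo; apply: xe.
have [c xic] := boundary_ex_ray xi; have [c' etac] := boundary_ex_ray eta.
have cr := boundary_ray xic; have cr' := boundary_ray etac.
have := ext_rays_cvg bcX (x := x) xic etac; rewrite Goo => /cvgeyPge H.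
have [[[delta hyp] _ _] _] := goodX.
apply: (boundary_eq xic etac); set o := c 0.
exists (4 * `|delta| + 3 * mdist o (c' 0)) => t t0.
have [s ts] := pinfty_ex_gt (num_real t) (H (t + mdist x o)); rewrite lee_fin => hs.
have s0 : 0 <= s by exact: le_trans (ltW ts).
have hs' : t <= gromov_product o (c s) (c' s).
  move: hs; rewrite /gromov_product; have := metric_triangle (c s) o x.
  by have := metric_triangle (c' s) o x; rewrite (metric_sym o x); lra.
have d0 := ler_norm delta; have d00 := normr_ge0 delta.
have d1 := metric_triangle o (c' 0) (c' s).
have d2 := metric_triangle o (c' 0) (c' t).
have d3 := metric_triangle (c' 0) o (c' s).
have d4 := metric_triangle (c' 0) o (c' t).
have dd := mdist_ge0 o (c' 0).
have e1 : mdist (c' 0) (c' s) = s by rewrite ray_dist// subr0.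
have e2 : mdist (c' 0) (c' t) = t by rewrite ray_dist// subr0.
have e3 : mdist (c' s) (c' t) = s - t by rewrite metric_sym ray_dist// ltW.
have e4 : mdist o (c t) = t by rewrite ray_dist// subr0.
have e5 : mdist o (c s) = s by rewrite ray_dist// subr0.
have e6 : mdist (c t) (c s) = s - t by rewrite ray_dist// ltW.
rewrite (metric_sym (c' 0) o) in d3 d4.
have p1 : gromov_product o (c t) (c s) = t.
  by rewrite /gromov_product !(metric_sym _ o) e4 e5 e6; lra.
have p2 : t - mdist o (c' 0) <= gromov_product o (c' s) (c' t).
  by rewrite /gromov_product !(metric_sym _ o) e3; lra.
(* Chain [c t], [c s], [c' s], [c' t] with [s] far beyond [t]: the outer products are about [t]
   because each pair lies on one ray, and the middle one is at least [t] by the choice of [s]. *)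
have := hyp o (c t) (c s) (c' t); have := hyp o (c s) (c' s) (c' t).
rewrite p1 !lerBlDr !ge_min.
have concl : t - mdist o (c' 0) - 2 * `|delta| <= gromov_product o (c t) (c' t) ->
    mdist (c t) (c' t) <= 4 * `|delta| + 3 * mdist o (c' 0).
  by rewrite /gromov_product !(metric_sym _ o) e4; lra.
by move=> /orP[] h1 /orP[] h2; apply: concl; lra.
Qed.

(* [-2 log] of the visual semi-metric. *)
Definition log_visual x xi eta : R :=
  2 * fine (ext_gromov_product x (inr xi, inr eta)).

Lemma visualE x xi eta : visual x xi eta =
  if xi == eta then 0 else expR (- log_visual x xi eta / 2).
Proof.
rewrite /visual; case: eqP => [->|/eqP xe]; first by rewrite ext_rays_diag.
rewrite -(fineK (ext_rays_fin x xe)) /=; congr expR; rewrite /log_visual; lra.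
Qed.

Lemma log_visual_sym x xi eta : log_visual x xi eta = log_visual x eta xi.
Proof. by rewrite /log_visual ext_rays_sym. Qed.

Lemma log_visual_ge0 x xi eta : 0 <= log_visual x xi eta.
Proof. by rewrite mulr_ge0// fine_ge0// ext_rays_ge0. Qed.

Lemma log_visual_cvg x xi eta c c' : xi != eta -> sval xi c -> sval eta c' ->
  2 * gromov_product x (c t) (c' t) @[t --> +oo] --> log_visual x xi eta.
Proof.
move=> xe xic etac; have := ext_rays_cvg bcX (x := x) xic etac.
rewrite -(fineK (ext_rays_fin x xe)) => /fine_cvg/= h.
by apply: cvgM; [exact: cvg_cst|exact: h].
Qed.

Lemma log_visual_change x y xi eta : xi != eta ->
  log_visual y xi eta = log_visual x xi eta - busemann x y xi - busemann x y eta.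
Proof.
move=> xe; have [c xic] := boundary_ex_ray xi; have [c' etac] := boundary_ex_ray eta.
apply: (cvg_unique (@Rhausdorff R) (log_visual_cvg (x := y) xe xic etac)).
have -> : (fun t => 2 * gromov_product y (c t) (c' t)) = (fun t =>
   2 * gromov_product x (c t) (c' t) - (mdist x (c t) - mdist y (c t))
     - (mdist x (c' t) - mdist y (c' t))).
  by apply/funext => t; rewrite /gromov_product !(metric_sym _ x) !(metric_sym _ y); lra.
by apply: cvgB; [apply: cvgB|]; [exact: log_visual_cvg|exact: busemann_cvg..].
Qed.

(** The geodesic from [y] to [z] is extended beyond [z]; seen from its endpoint at infinity, the
    whole distance counts. *)
Lemma busemann_attained y z : exists xi, busemann y z xi = mdist y z.
Proof.
have [[_ _ geo] [gc _ [s _]]] := goodX.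
have [yz|yz] := eqVneq y z.
  by exists (s ord0); rewrite yz busemann_xx// mdistxx.
have [c [ciso c0 cd]] := geo y z.
have [c' c'iso cc'] := gc 0 _ c (mdist_ge0 y z) ciso.
have cr : is_ray c' by move=> p q _ _; exact: c'iso.
exists (endpoint cr); have := busemann_cvg bcX (x := y) (y := z) (endpointP cr).
move=> h; apply: (cvg_unique (@Rhausdorff R) h); apply: cvg_near_cst; near=> t.
have tyz : mdist y z <= t by near: t; apply: nbhs_pinfty_ge; exact: num_real.
have e0 : c' 0 = y by rewrite cc'// in_itv/= lexx mdist_ge0.
have e : c' (mdist y z) = z by rewrite cc'// in_itv/= lexx mdist_ge0.
have d0 := mdist_ge0 y z.
have := ray_dist cr (lexx 0) (le_trans d0 tyz).
by have := ray_dist cr d0 tyz; rewrite e e0; lra.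
Unshelve. all: by end_near. Qed.

End GoodBoundary.

(** Pigeonhole over time: otherwise each index fails from some time on, and all of them fail at the
    largest of these times. *)
Lemma frequently_fin {R : realType} (I : finType) (P : I -> R -> Prop) :
  (forall t, 0 <= t -> exists i, P i t) ->
  exists i, forall M, exists t, [/\ M <= t, 0 <= t & P i t].
Proof.
move=> H; apply: contrapT => /forallNP nP.
have /choice[M MP] : forall i, exists M : R, forall t, M <= t -> 0 <= t -> ~ P i t.
  move=> i; have /existsNP[M nM] := nP i; exists M => t Mt t0 Pt.
  by apply: nM; exists t.
pose T := \big[Num.max/0]_i M i.
have [i] := H T (bigmax_ge_id _ _ _ _).
by apply: MP; [exact: le_bigmax|exact: bigmax_ge_id].
Qed.

(** * Finite boundaries: antipodes and discreteness *)

Section FiniteBoundary.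
Context {R : realType} {X : metricType R} {n : nat}.
Hypothesis goodX : good_hyperbolic X.
Variable b : 'I_n -> boundary X.
Hypothesis b_surj : forall xi, exists i, b i = xi.
Implicit Types (x y z o : X) (c : R -> X) (xi eta : boundary X).

Let bcX : boundary_continuous X. Proof. by case: goodX => _ []. Qed.

Lemma geodesic_backward y z : exists eta,
  ext_gromov_product y (inr eta, inl z) = 0%E.
Proof.
have [[_ _ geo] [gc _ _]] := goodX.
have [c [ciso c0 cd]] := geo y z; have d0 := mdist_ge0 y z.
have [c' c'iso cc'] := gc 0 _ c d0 ciso.
have e0 : c' 0 = y by rewrite cc'// in_itv/= lexx mdist_ge0.
have e : c' (mdist y z) = z by rewrite cc'// in_itv/= lexx mdist_ge0.
have cr : is_ray (fun t => c' (- t)).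
  by move=> p q _ _; rewrite c'iso// -opprD normrN.
exists (endpoint cr).
have h := ext_ray_cvg bcX (x := y) (y := z) (endpointP cr).
apply: (cvg_unique (@ereal_hausdorff R) h); apply: cvg_near_cst; near=> t.
have t0 : 0 <= t by near: t; exact: nbhs_pinfty_ge.
rewrite /gromov_product; congr (_%:E); rewrite -{1}e0 -{2}e (metric_sym z) !c'iso//.
rewrite subr0 normrN ger0_norm// ler0_norm; last by lra.
lra.
Unshelve. all: by end_near. Qed.

(** Along a ray to [xi], extending the geodesic from [y] to [c t] backwards gives a boundary point
    whose product with [c t] is zero. Finiteness of the boundary replaces compactness of the
    backward rays: one such point serves at arbitrarily large times, and the product passes to the
    limit. *)
Lemma log_visual_antipodal y xi : exists2 eta, eta != xi & log_visual y xi eta = 0.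
Proof.
have [c xic] := boundary_ex_ray xi.
have [i iP] : exists i, forall M, exists t, [/\ M <= t, 0 <= t &
    ext_gromov_product y (inr (b i), inl (c t)) = 0%E].
  apply: frequently_fin => t t0; have [eta he] := geodesic_backward y (c t).
  by have [i bi] := b_surj eta; exists i; rewrite bi.
have lim : ext_gromov_product y (inr (b i), inl (c t)) @[t --> +oo] -->
    ext_gromov_product y (inr (b i), inr xi).
  by apply: ext_continuous => //; [exact: cvg_cst|exact: ray_cvg].
have G0 : ext_gromov_product y (inr (b i), inr xi) = 0%E.
  apply: contrapT => ne.
  have op : open (~` [set 0%E : \bar R]).
    apply: closed_openC; apply: accessible_closed_set1.
    by apply: hausdorff_accessible; exact: ereal_hausdorff.
  have [M [_ HM]] := lim _ (open_nbhs_nbhs (conj op ne)).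
  (* Neighbourhoods of [+oo] require [M < t], while [iP] provides a non-strict bound; hence
     [M + 1]. *)
  by have [t [Mt _ /HM]] := iP (M + 1); apply; lra.
exists (b i); last by rewrite /log_visual ext_rays_sym// G0 mulr0.
by apply/eqP => bi; move: G0; rewrite bi ext_rays_diag.
Qed.

(** The product with [xi] is continuous, infinite at [xi] and bounded by [K] at the finitely many
    other boundary points. Hence bijections between finite boundaries are automatically
    homeomorphisms. *)
Lemma boundary_discrete xi : open [set xi].
Proof.
have [c xic] := boundary_ex_ray xi; set x := c 0.
pose K := \big[Num.max/0]_i fine (ext_gromov_product x (inr xi, inr (b i))).
pose U := [set z : bordification X | (K%:E < ext_gromov_product x (inr xi, z))%E].
exists U.
  have zc : continuous (fun z : bordification X => ext_gromov_product x (inr xi, z)).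
    move=> z; apply: (@ext_continuous _ _ bcX x _ (nbhs z) (nbhs_pfilter z));
      last exact: cvg_id.
    exact: (@cvg_cst _ _ _ _ (nbhs_filter z)).
  have /continuousP := zc; move=> /(_ [set e | (K%:E < e)%E]); apply.
  exact: open_ereal_gt_ereal.
apply/seteqP; split=> [eta|eta ->]; rewrite /U/= ?ext_rays_diag ?ltry//.
apply: contraPeq => xe; apply/negP; rewrite -leNgt; have [i bi] := b_surj eta.
have xe' : xi != eta by rewrite eq_sym.
rewrite -(fineK (ext_rays_fin goodX x xe')) lee_fin -bi.
exact: (le_bigmax _ (fun i => fine (ext_gromov_product x (inr xi, inr (b i))))).
Qed.

Lemma boundary_map_continuous (T : topologicalType) (g : boundary X -> T) :
  continuous g.
Proof.
apply/continuousP => A _; have -> : g @^-1` A = \bigcup_(xi in g @^-1` A) [set xi].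
  by apply/seteqP; split=> [xi gxi|_ [xi gxi ->]]//; exists xi.
by apply: bigcup_open => xi _; exact: boundary_discrete.
Qed.

End FiniteBoundary.

(** * The boundary of a tight span *)

Section TSpaceBoundary.
Context {R : realType} {n : nat}.
Variables (D : 'I_n.+2 -> 'I_n.+2 -> R) (K : R).
Notation k := n.+2.
Notation M := (tspace D).
Hypothesis symD : forall i j, D i j = D j i.
Hypothesis span0 : tight_span D 0.
Hypothesis DK : forall i j, D i j <= K.
Implicit Types (x y z o : M) (c : R -> M) (i j l : 'I_k).

Local Notation coord y i := (sval y 0 i).

Let f0 : feasible D 0. Proof. by case: span0. Qed.

Lemma coord_lip x y i : `|coord x i - coord y i| <= mdist x y.
Proof. exact: rV_dist_ge. Qed.

Lemma is_ray_ray_pt x i : is_ray (ray_pt symD x i).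
Proof. by move=> s t /= s0 t0; apply: span_ray_dist => //; exact: svalP. Qed.

(** At each time some coordinate has grown by the full distance [t]; one index does so at unbounded
    times, and since coordinates are 1-Lipschitz it then does so at every earlier time. *)
Lemma tspace_ray_coord c : is_ray c ->
  exists i, forall t, 0 <= t -> coord (c t) i = coord (c 0) i + t.
Proof.
move=> cr; have [i iP] : exists i, forall N, exists t, [/\ N <= t, 0 <= t &
    coord (c t) i - coord (c 0) i = t].
  apply: frequently_fin => t t0.
  have [i [_ [_ + _ _ _]]] := span_dist_attained (svalP (c 0)) (svalP (c t)).
  move=> e; exists i; rewrite e -(tspace_mdistE (c t)) metric_sym.
  by rewrite ray_dist// subr0.
exists i => t t0; have [s [ts s0 e]] := iP t.
have := coord_lip (c s) (c t) i; have := coord_lip (c t) (c 0) i.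
rewrite metric_sym (metric_sym (c s)) !ray_dist// !ler_norml.
by move=> /andP[? ?] /andP[? ?]; lra.
Qed.

Lemma tspace_asymptotic c c' i : is_ray c -> is_ray c' ->
  (forall t, 0 <= t -> coord (c t) i = coord (c 0) i + t) ->
  (forall t, 0 <= t -> coord (c' t) i = coord (c' 0) i + t) ->
  asymptotic c c'.
Proof.
move=> cr cr' ci ci'.
pose T := Num.max 0 (Num.max (K - coord (c 0) i) (K - coord (c' 0) i)).
have T0 : 0 <= T by rewrite le_max lexx.
have T1 : K - coord (c 0) i <= T by rewrite !le_max lexx !orbT.
have T2 : K - coord (c' 0) i <= T by rewrite !le_max lexx !orbT.
exists (2 * T + mdist (c 0) (c' 0)) => t t0; have [tT|Tt] := leP t T.
  have := metric_triangle (c t) (c 0) (c' t).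
  have := metric_triangle (c 0) (c' 0) (c' t).
  by rewrite (metric_sym (c t) (c 0)) !ray_dist//; lra.
have h1 : K < coord (c t) i by rewrite ci//; lra.
have h2 : K < coord (c' t) i by rewrite ci'//; lra.
rewrite (tspace_mdistE (c t)) (far_dist_same symD f0 DK (svalP (c t)) (svalP (c' t)) h1 h2).
rewrite ci// ci'// opprD addrACA subrr addr0.
by have := coord_lip (c 0) (c' 0) i; lra.
Qed.

Lemma tspace_not_asymptotic c c' i j : i != j ->
  (forall t, 0 <= t -> coord (c t) i = coord (c 0) i + t) ->
  (forall t, 0 <= t -> coord (c' t) j = coord (c' 0) j + t) ->
  ~ asymptotic c c'.
Proof.
move=> ij ci cj [C H].
pose X := C + D i j - coord (c 0) i - coord (c' 0) j.
have [t t0 Xt] : exists2 t, 0 <= t & X < t.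
  by exists (`|X| + 1); have := ler_norm X; have := normr_ge0 X; lra.
have := coord_lip (c t) (c' t) i; rewrite ci// ler_norml => /andP[_].
have := (svalP (c' t)).1 i j ij; rewrite cj//.
by have := H t t0; rewrite /X in Xt; lra.
Qed.

Definition end_pt i : boundary M := endpoint (is_ray_ray_pt (origin span0) i).

Lemma ray_pt_coord x i t : 0 <= t ->
  coord (ray_pt symD x i t) i = coord (ray_pt symD x i 0) i + t.
Proof. by move=> t0; rewrite /= !span_ray_coord ?addr0//; exact: svalP. Qed.

Lemma end_pt_rayP i c : sval (end_pt i) c ->
  forall t, 0 <= t -> coord (c t) i = coord (c 0) i + t.
Proof.
move=> ic; have cr := boundary_ray ic; have [j jP] := tspace_ray_coord cr.
have as_ := boundary_asymptotic ic (endpointP (is_ray_ray_pt _ _)).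
suff -> : i = j by [].
apply/eqP/negPn/negP; rewrite eq_sym => ji.
exact: tspace_not_asymptotic ji jP (@ray_pt_coord _ _) as_.
Qed.

Lemma end_ptP i c : is_ray c ->
  (forall t, 0 <= t -> coord (c t) i = coord (c 0) i + t) -> sval (end_pt i) c.
Proof.
move=> cr ci; split => //.
exact: tspace_asymptotic (is_ray_ray_pt _ _) cr (@ray_pt_coord _ _) ci.
Qed.

Lemma end_pt_inj : injective end_pt.
Proof.
move=> i j ij; apply/eqP/negPn/negP => ne.
have hj : sval (end_pt j) (ray_pt symD (origin span0) i).
  by rewrite -ij; exact: endpointP.
have as_ := boundary_asymptotic hj (endpointP (is_ray_ray_pt _ _)).
exact: tspace_not_asymptotic ne (@ray_pt_coord _ _) (@ray_pt_coord _ _) as_.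
Qed.

Lemma end_pt_surj xi : exists i, end_pt i = xi.
Proof.
have [c xic] := boundary_ex_ray xi; have cr := boundary_ray xic.
have [i ci] := tspace_ray_coord cr; exists i.
apply: (boundary_eq (end_ptP cr ci) xic); exists 0 => t _; by rewrite mdistxx.
Qed.

Definition end_index xi : 'I_k := sval (cid (end_pt_surj xi)).

Lemma end_indexK xi : end_pt (end_index xi) = xi.
Proof. by rewrite /end_index; case: cid. Qed.

Lemma end_ptK i : end_index (end_pt i) = i.
Proof. by apply: end_pt_inj; rewrite end_indexK. Qed.

(* Limit of the Gromov product of y with a point going to the end i. *)
Definition end_product o i y : R := (mdist y o + coord y i - coord o i) / 2.

Lemma far_mdist y z i : K + `|sval z| < coord y i ->
  mdist y z = coord y i - coord z i.
Proof. by apply: (far_dist DK); exact: svalP. Qed.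

(** Far out in an end the products stop depending on [y]. The extension to the boundary is thus an
    eventually constant value rather than a genuine limit. *)
Lemma far_product o y z i : K + `|sval o| < coord y i ->
  K + `|sval z| < coord y i -> gromov_product o y z = end_product o i z.
Proof.
by move=> h1 h2; rewrite /gromov_product /end_product (far_mdist h1) (far_mdist h2); lra.
Qed.

Lemma far_end_product o y i : K + `|sval o| < coord y i ->
  end_product o i y = coord y i - coord o i.
Proof. by move=> h1; rewrite /end_product (far_mdist h1); lra. Qed.

Lemma far_end_product_diff o y i j : i != j -> K + `|sval o| < coord y i ->
  end_product o j y = (D i j - coord o i - coord o j) / 2.
Proof.
move=> ij h1; rewrite /end_product (far_mdist h1).
have h2 : K < coord y i by have := normr_ge0 (sval o); lra.
have ji : j != i by rewrite eq_sym.
by rewrite (far_coord symD f0 DK (svalP y) h2 ji); lra.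
Qed.

Lemma far_product_same o y z i (r : R) : K + `|sval o| < coord y i ->
  K + `|sval o| < coord z i -> r < coord y i - coord o i ->
  r < coord z i - coord o i -> r < gromov_product o y z.
Proof.
move=> h1 h2 h3 h4; rewrite /gromov_product (far_mdist h1) (far_mdist h2).
have o0 := normr_ge0 (sval o).
have [k1 k2] : K < coord y i /\ K < coord z i by lra.
rewrite (tspace_mdistE y) (far_dist_same symD f0 DK (svalP y) (svalP z) k1 k2).
by have [h|h] := leP 0 (coord y i - coord z i); [rewrite ger0_norm//|rewrite ltr0_norm//];
  lra.
Qed.

Lemma far_product_diff o y z i j : i != j -> K + `|sval o| < coord y i ->
  K + `|sval o| < coord z j ->
  gromov_product o y z = (D i j - coord o i - coord o j) / 2.
Proof.
move=> ij h1 h2; rewrite /gromov_product (far_mdist h1) (far_mdist h2).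
have o0 := normr_ge0 (sval o).
have [k1 k2] : K < coord y i /\ K < coord z j by lra.
rewrite (tspace_mdistE y) (far_dist_diff symD f0 DK (svalP y) (svalP z) ij k1 k2).
by lra.
Qed.

Lemma end_product_lip o i y y' :
  `|end_product o i y - end_product o i y'| <= mdist y y'.
Proof.
rewrite /end_product ler_norml; have := metric_triangle y y' o.
have := metric_triangle y' y o; rewrite (metric_sym y' y).
have := coord_lip y y' i; rewrite ler_norml => /andP[? ?] ? ?.
by apply/andP; split; lra.
Qed.

(** A large product with the end [i] makes [|y - o| + y_i - o_i] at least [2 * r]. If the distance
    to [o] were attained at another index [l], feasibility [y_l + y_i <= K] would keep this quantity
    too small. *)
Lemma shadow_end o i c y (r K' : R) : sval (end_pt i) c ->
  K + `|sval o| < r -> K' + `|sval o| < r ->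
  (exists T, forall t, T <= t -> r <= gromov_product o y (c t)) ->
  K' < coord y i.
Proof.
move=> ic r1 r2 [T HT]; have cP := end_pt_rayP ic.
pose t := Num.max T (Num.max 0 (K + `|sval o| - coord (c 0) i + 1)).
have t1 : T <= t by rewrite le_max lexx.
have t0 : 0 <= t by rewrite !le_max lexx orbT.
have t2 : K + `|sval o| - coord (c 0) i + 1 <= t by rewrite !le_max lexx !orbT.
have tf : K + `|sval o| < coord (c t) i by rewrite cP//; lra.
have := HT t t1; rewrite /gromov_product (far_mdist tf).
have := coord_lip (c t) y i; rewrite (metric_sym _ y) ler_norml cP// => /andP[_ h] h1.
have [l [_ [_ e _ _ _]]] := span_dist_attained (svalP o) (svalP y).
rewrite -(tspace_mdistE y) in e; rewrite -e in h1.
have := rV_norm_ge (sval o) i; have := rV_norm_ge (sval o) l.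
rewrite !ler_norml => /andP[u1 u2] /andP[u3 u4].
have [li|li] := eqVneq l i; first by rewrite li in h1; lra.
have := (svalP y).1 l i li; have := DK l i; have := feasible0_ge0 f0 li; lra.
Qed.

(** Shadows are cut out by non-strict inequalities and are not visibly open; continuity at the end
    [i] is tested on these sets instead. *)
Definition end_nbhd i (K' : R) : set (bordification M) :=
  [set z | match z with inl y => K' < coord (y : M) i | inr xi => xi = end_pt i end].

Lemma end_nbhd_open i K' : open (end_nbhd i K').
Proof.
split=> [y /= yi|xi /= -> o].
  exists (coord y i - K'); first by rewrite subr_gt0.
  move=> y'; rewrite ballEmdist/= => h; have := coord_lip y y' i.
  by rewrite ler_norml => /andP[_]; lra.
exists (Num.max K K' + `|sval o| + 1).
have [m1 m2] : K <= Num.max K K' /\ K' <= Num.max K K'.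
  by rewrite !le_max !lexx orbT.
move=> [y|eta] /=.
  move=> [c ic]; apply: (shadow_end ic); lra.
move=> [c [c' [ic etac [T HT]]]]; rewrite -(end_indexK eta) in etac *.
congr end_pt; apply/eqP/negPn/negP => ji.
have cP := end_pt_rayP etac; set j := end_index eta in etac ji cP.
pose t := Num.max T (Num.max 0 (D i j - coord (c' 0) j - K')).
have t1 : T <= t by rewrite le_max lexx.
have t0 : 0 <= t by rewrite !le_max lexx orbT.
have t2 : D i j - coord (c' 0) j - K' <= t by rewrite !le_max lexx !orbT.
have : K' < coord (c' t) i.
  apply: (shadow_end ic (o := o) (r := Num.max K K' + `|sval o| + 1)); try lra.
  by exists T => s Ts; rewrite gromov_product_sym; exact: HT.
have := (svalP (c' t)).1 i j; rewrite eq_sym cP// => /(_ ji); lra.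
Qed.

Lemma inl_ball_open y (e : R) :
  open [set z : bordification M | match z with inl y' => mdist y y' < e | _ => False end].
Proof.
split=> [y' /= yy'|//]; exists (e - mdist y y'); first by rewrite subr_gt0.
move=> z; rewrite ballEmdist/= => h.
by have := metric_triangle y y' z; lra.
Qed.

End TSpaceBoundary.

(** * Boundary continuity of the span *)

Section TSpaceExtension.
Context {R : realType} {n : nat}.
Variables (D : 'I_n.+2 -> 'I_n.+2 -> R) (K : R).
Notation k := n.+2.
Notation M := (tspace D).
Hypothesis symD : forall i j, D i j = D j i.
Hypothesis span0 : tight_span D 0.
Hypothesis DK : forall i j, D i j <= K.
Variable o : M.
Implicit Types (x y z : M) (c : R -> M) (i j l : 'I_k).

Local Notation coord y i := (sval y 0 i).
Local Notation end_pt := (end_pt symD span0).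
Local Notation end_index := (end_index symD span0 DK).
Local Notation end_indexK := (end_indexK symD span0 DK).

Definition end_extension (p : bordification M * bordification M) : \bar R :=
  match p with
  | (inl y, inl z) => (gromov_product o y z)%:E
  | (inr xi, inl z) => (end_product o (end_index xi) z)%:E
  | (inl y, inr eta) => (end_product o (end_index eta) y)%:E
  | (inr xi, inr eta) => if end_index xi == end_index eta then +oo%E else
      ((D (end_index xi) (end_index eta)
        - coord o (end_index xi) - coord o (end_index eta)) / 2)%:E
  end.

Lemma end_extension_sym a b : end_extension (a, b) = end_extension (b, a).
Proof.
case: a => [y|xi]; case: b => [z|eta] //=; first by rewrite gromov_product_sym.
rewrite eq_sym; case: ifP => // _; congr (_%:E); rewrite symD; lra.
Qed.

Let nbhs_real (r : R) (A : set (\bar R)) : nbhs r%:E A ->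
  exists2 e, 0 < e & forall s, `|r - s| < e -> A s%:E.
Proof.
by move=> /nbhs_EFin/nbhs_ballP[e /= e0 H]; exists e.
Qed.

Let continuous_pair (a b : bordification M) : Prop :=
  forall A, nbhs (end_extension (a, b)) A -> exists U V,
    [/\ open U /\ U a, open V /\ V b & forall p q, U p -> V q -> A (end_extension (p, q))].

Let continuous_pair_sym a b : continuous_pair a b -> continuous_pair b a.
Proof.
move=> H A; rewrite end_extension_sym => /H[U [V [Ua Vb UV]]]; exists V, U; split => //.
by move=> p q Vp Uq; rewrite end_extension_sym; exact: UV.
Qed.

Let continuous_inl_inl y z : continuous_pair (inl y) (inl z).
Proof.
move=> A /nbhs_real[e e0 eA].
have e2 : 0 < e / 2 by rewrite divr_gt0.
exists [set p : bordification M | match p with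
  | inl y' => mdist y y' < e / 2 | _ => False end].
exists [set p : bordification M | match p with
  | inl y' => mdist z y' < e / 2 | _ => False end].
split; first by rewrite /= mdistxx; split=> //; exact: inl_ball_open.
  by rewrite /= mdistxx; split=> //; exact: inl_ball_open.
move=> [y'|//] [z'|//] /= yy' zz'; apply: eA.
by apply: le_lt_trans (gromov_product_lip _ _ _ _ _) _; lra.
Qed.

Let continuous_inr_inl i z : continuous_pair (inr (end_pt i)) (inl z).
Proof.
move=> A; rewrite /= end_ptK => /nbhs_real[e e0 eA].
(* Since [d <= 1], every [z'] near [z] has norm below [|z| + 1], so this threshold is far with
   respect to all of them and to [o]. *)
pose K' := K + `|sval z| + 1 + `|sval o|; pose d := Num.min 1 e.
have d0 : 0 < d by rewrite lt_min ltr01 e0.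
have [d1 de] : d <= 1 /\ d <= e by rewrite !ge_min !lexx orbT.
exists (end_nbhd symD span0 i K').
exists [set p : bordification M | match p with inl y' => mdist z y' < d | _ => False end].
split; first by split=> //; exact: (end_nbhd_open symD span0 DK).
  by rewrite /= mdistxx; split=> //; exact: inl_ball_open.
move=> p [z'|//] /= ip zz'; have near_z : A (end_product o i z')%:E.
  apply: eA; apply: le_lt_trans (end_product_lip _ _ _ _) _; lra.
case: p ip => [y|xi] /= yi; last by rewrite yi end_ptK.
have := ler_distD (sval z) (sval z') 0; rewrite !subr0 distrC -(tspace_mdistE z) => zn.
have o0 := normr_ge0 (sval o); have z0 := normr_ge0 (sval z).
rewrite /K' in yi.
by rewrite (far_product DK (i := i))//; lra.
Qed.

Let continuous_inr_same i : continuous_pair (inr (end_pt i)) (inr (end_pt i)).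
Proof.
move=> A; rewrite /= eqxx => -[N [_ NA]].
pose K' := Num.max (K + `|sval o|) (N + coord o i).
have [k1 k2] : K + `|sval o| <= K' /\ N + coord o i <= K'.
  by rewrite !le_max !lexx orbT.
exists (end_nbhd symD span0 i K'), (end_nbhd symD span0 i K').
split; try by split=> //; exact: (end_nbhd_open symD span0 DK).
move=> [y|xi] [z|eta] /= py pz; apply: NA; rewrite ?py ?pz ?end_ptK ?eqxx ?ltry// lte_fin.
- by apply: (far_product_same symD span0 DK (i := i)); lra.
- by rewrite (far_end_product DK); lra.
- by rewrite (far_end_product DK); lra.
Qed.

Let continuous_inr_diff i j : i != j -> continuous_pair (inr (end_pt i)) (inr (end_pt j)).
Proof.
move=> ij A; rewrite /= !end_ptK (negbTE ij) => /nbhs_singleton lA.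
pose K' := K + `|sval o|.
exists (end_nbhd symD span0 i K'), (end_nbhd symD span0 j K').
split; try by split=> //; exact: (end_nbhd_open symD span0 DK).
have ji : j != i by rewrite eq_sym.
move=> [y|xi] [z|eta] /= py pz; rewrite ?py ?pz ?end_ptK ?(negbTE ij)//.
- by rewrite (far_product_diff symD span0 DK ij).
- by rewrite (far_end_product_diff symD span0 DK ij).
- rewrite (far_end_product_diff symD span0 DK ji)// symD.
  by rewrite (_ : _ - _ - _ = D i j - coord o i - coord o j)//; lra.
Qed.

Lemma end_extension_continuous : continuous_gromov_extension o end_extension.
Proof.
split=> // -[a b] A; have main : continuous_pair a b.
  case: a => [y|xi]; case: b => [z|eta].
  - exact: continuous_inl_inl.
  - by rewrite -(end_indexK eta); apply: continuous_pair_sym; exact: continuous_inr_inl.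
  - by rewrite -(end_indexK xi); exact: continuous_inr_inl.
  rewrite -(end_indexK xi) -(end_indexK eta).
  have [->|ij] := eqVneq (end_index xi) (end_index eta); first exact: continuous_inr_same.
  exact: continuous_inr_diff.
move=> /main[U [V [Ua Vb UV]]]; exists (U, V) => /=.
  by split; exact: open_nbhs_nbhs.
by move=> [p q] [Up Vq]; exact: UV.
Qed.

End TSpaceExtension.

Section TSpaceIsGood.
Context {R : realType} {n : nat}.
Variables (D : 'I_n.+4 -> 'I_n.+4 -> R).
Notation k := n.+4.
Notation M := (tspace D).
Hypothesis symD : forall i j, D i j = D j i.
Hypothesis span0 : tight_span D 0.

Lemma tspace_good : good_hyperbolic M.
Proof.
have [K K0 DK] := upper_bound_ex D.
split; split.
- exact: tspace_hyperbolic symD span0.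
- exact: tspace_proper symD.
- exact: tspace_geodesic symD.
- exact: tspace_geodesically_complete symD.
- by move=> o; exists (end_extension symD span0 DK o); exact: end_extension_continuous.
- exists (fun s : 'I_4 => end_pt symD span0 (widen_ord (isT : 4 <= n.+4)%N s)).
  by move=> s t /end_pt_inj/(congr1 val)/= /val_inj.
Qed.

Lemma tspace_log_visual (o : M) i j : i != j ->
  log_visual o (end_pt symD span0 i) (end_pt symD span0 j) =
  D i j - sval o 0 i - sval o 0 j.
Proof.
move=> ij; have [K K0 DK] := upper_bound_ex D.
have bij : end_pt symD span0 i != end_pt symD span0 j.
  by apply: contra_neq ij; exact: end_pt_inj.
have ri := endpointP (is_ray_ray_pt symD (origin span0) i).
have rj := endpointP (is_ray_ray_pt symD (origin span0) j).
apply: (cvg_unique (@Rhausdorff R) (log_visual_cvg tspace_good (x := o) bij ri rj)).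
apply: cvg_near_cst; near=> t.
have t0 : 0 <= t by near: t; exact: nbhs_pinfty_ge.
have tK : K + `|sval o| < t by near: t; apply: nbhs_pinfty_gt; exact: num_real.
rewrite (far_product_diff symD span0 DK ij); first lra.
- by rewrite span_ray_coord//= mxE add0r.
- by rewrite span_ray_coord//= mxE add0r.
Unshelve. all: by end_near. Qed.

End TSpaceIsGood.

(** * Maximal spaces are tight spans *)

(* Far out on the ray of index i the only tight pairs are the (i, j), so a
   translation preserving the span has v_i + v_j = 0 for all distinct i, j. *)
Lemma tight_span_translation {R : realType} {n : nat}
    (D : 'I_n.+3 -> 'I_n.+3 -> R) (v : 'rV[R]_n.+3) :
  (forall i j, D i j = D j i) -> tight_span D 0 ->
  (forall u, tight_span D u -> tight_span D (u + v)) -> v = 0.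
Proof.
move=> symD span0 vP; have [K K0 DK] := upper_bound_ex D.
have f0 := span0.1.
have opp i j : j != i -> v 0 i + v 0 j = 0.
  move=> ji; pose t := K + `|v| + 1; have vn := normr_ge0 v.
  have t0 : 0 <= t by rewrite /t; lra.
  pose u := span_ray D 0 i t; have uT : tight_span D u by exact: span_ray_span.
  have ui : u 0 i = t by rewrite span_ray_coord// mxE add0r.
  have uK : K < u 0 i by rewrite ui /t; lra.
  have uE l : l != i -> u 0 l = D i l - t.
    by move=> li; rewrite (far_coord symD f0 DK uT uK li) ui.
  have [l lj] := (vP u uT).2 j; rewrite !mxE uE//.
  have [->|li] := eqVneq l i; first by rewrite ui symD; lra.
  rewrite uE//; have := DK i l; have := DK i j.
  have := feasible0_ge0 f0 lj; rewrite (symD l j).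
  have := rV_norm_ge v j; have := rV_norm_ge v l.
  by rewrite !ler_norml => /andP[? ?] /andP[? ?]; rewrite /t; lra.
apply/rowP => i; rewrite mxE; have neq (a : 'I_n.+2) : lift i a != i.
  by rewrite eq_sym neq_lift.
(* Three distinct indices whose pairwise sums all vanish force each coordinate to vanish; two
   indices would leave one degree of freedom. *)
have ab : lift i (lift ord0 ord0 : 'I_n.+2) != lift i ord0.
  by rewrite (inj_eq lift_inj) eq_sym neq_lift.
by have := opp i _ (neq ord0); have := opp i _ (neq (lift ord0 ord0));
   have := opp _ _ ab; lra.
Qed.

Lemma boundary_enum {R : realType} (X : metricType R) :
  good_hyperbolic X -> finite_set [set: boundary X] ->
  exists n (b : 'I_n.+4 -> boundary X), injective b /\ forall xi, exists i, b i = xi.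
Proof.
move=> [_ [_ _ [f finj]]] /finite_seqP[s0 s0P]; pose s := undup s0.
have sP xi : xi \in s by have : [set: boundary X] xi by []; rewrite s0P mem_undup.
have us : uniq s := undup_uniq s0.
have s4 : (4 <= size s)%N.
  have := @uniq_leq_size _ (codom f) s; rewrite size_codom card_ord; apply.
    by apply/injectiveP.
  by move=> xi _; exact: sP.
have inj : injective (tnth (in_tuple s)) by exact/tuple_uniqP.
have surj xi : exists i, tnth (in_tuple s) i = xi.
  by have /(tnthP (in_tuple s))[i ->] := sP xi; exists i.
move: (tnth (in_tuple s)) inj surj s4; case: (size s) => [|[|[|[|n]]]]// b *.
by exists n, b.
Qed.

Section MaximalChart.
Context {R : realType} {X : metricType R} {n : nat}.
Hypothesis maxX : maximal_hyperbolic X.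
Variables (x : X) (b : 'I_n.+4 -> boundary X).
Hypothesis b_inj : injective b.
Hypothesis b_surj : forall xi, exists i, b i = xi.

Let goodX : good_hyperbolic X. Proof. by case: maxX. Qed.
Let bcX : boundary_continuous X. Proof. by case: goodX => _ []. Qed.

Definition log_matrix i j := log_visual x (b i) (b j).

Definition busemann_coords (y : X) : 'rV[R]_n.+4 := \row_i busemann x y (b i).

Local Notation D := log_matrix.
Local Notation Phi := busemann_coords.

Lemma log_matrix_sym i j : D i j = D j i.
Proof. exact: log_visual_sym. Qed.

Let b_neq i j : i != j -> b i != b j. Proof. by rewrite (inj_eq b_inj). Qed.

Lemma log_visual_coords y i j : i != j ->
  log_visual y (b i) (b j) = D i j - Phi y 0 i - Phi y 0 j.
Proof. by move=> ij; rewrite !mxE -log_visual_change// b_neq. Qed.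

(** Read from the base point [y], feasibility is the nonnegativity of Gromov products and tightness
    is the existence of antipodes. *)
Lemma busemann_coords_span y : tight_span D (Phi y).
Proof.
split=> [i j ij|i].
  have := log_visual_ge0 goodX y (b i) (b j); rewrite log_visual_coords//; lra.
have [eta] := log_visual_antipodal goodX b_surj y (b i).
have [j <-] := b_surj eta; rewrite (inj_eq b_inj) => ji.
by rewrite log_visual_coords 1?eq_sym// => e; exists j => //; lra.
Qed.

Lemma busemann_coords_base : Phi x = 0.
Proof. by apply/rowP => i; rewrite !mxE busemann_xx. Qed.

Lemma busemann_coords_isometry y z : `|Phi y - Phi z| = mdist y z.
Proof.
have E i : Phi y 0 i - Phi z 0 i = - busemann y z (b i).
  by rewrite !mxE (busemann_cocycle bcX x y z); lra.
apply/eqP; rewrite eq_le; apply/andP; split.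
  apply/rV_distP => [|i]; first exact: mdist_ge0.
  by rewrite E normrN busemann_le.
have [xi] := busemann_attained goodX y z; have [i <-] := b_surj xi => <-.
by apply: le_trans (rV_dist_ge (Phi y) (Phi z) i); rewrite E normrN ler_norm.
Qed.

Let span0 : tight_span D 0.
Proof. by rewrite -busemann_coords_base; exact: busemann_coords_span. Qed.

Let cross_ratio_expR (Z : Type) (rho : Z -> Z -> R) (p q r s : Z) (e1 e2 e3 e4 : R) :
  rho p r = expR e1 -> rho q s = expR e2 -> rho p s = expR e3 -> rho q r = expR e4 ->
  cross_ratio rho p q r s = expR (e1 + e2 - e3 - e4).
Proof.
by rewrite /cross_ratio => -> -> -> ->; rewrite -!expRD -expRB; congr expR; lra.
Qed.

(** The identification of the ends of the span with the boundary of [X] is Moebius: a change of base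
    point multiplies the visual semi-metric by factors attached to single points, which cancel in
    cross-ratios. Maximality then embeds the span into [X] by some [F], which is not known to send
    the origin to [x]; so [Phi \o F] is a translation, and [tight_span_translation] shows that it is
    trivial. *)
Lemma busemann_coords_surj u : tight_span D u -> exists y, Phi y = u.
Proof.
have [K K0 DK] := upper_bound_ex D; set symD := log_matrix_sym.
have goodM := tspace_good symD span0.
pose idx := end_index symD span0 DK; pose pt := end_pt symD span0.
pose g xi := b (idx xi); have gpt i : g (pt i) = b i by rewrite /g /idx end_ptK.
have ptE xi : exists i, xi = pt i.
  by have [i <-] := end_pt_surj symD span0 DK xi; exists i.
have ptI : injective pt by exact: end_pt_inj.
have gM : moebius_homeo g.
  split.
    have /choice[h hP] := b_surj; exists (pt \o h); split.
    - by move=> xi; have [i ->] := ptE xi; rewrite gpt /=; congr pt; exact: b_inj.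
    - by move=> xi; rewrite /= gpt.
    - exact: (boundary_map_continuous goodM (end_pt_surj symD span0 DK)).
    - exact: (boundary_map_continuous goodX b_surj).
  move=> y x' xi xi' eta eta'.
  have [[i ->] [i' ->]] := (ptE xi, ptE xi').
  have [[j ->] [j' ->]] := (ptE eta, ptE eta').
  rewrite !gpt /= !inE !(inj_eq ptI) !negb_or.
  move=> /and4P[/and3P[ii' ij ij'] /andP[i'j i'j'] jj' _].
  have vM p q : p != q ->
      visual y (pt p) (pt q) = expR (- (D p q - sval y 0 p - sval y 0 q) / 2).
    by move=> pq; rewrite (visualE goodM) (inj_eq ptI) (negbTE pq) tspace_log_visual.
  have vX p q : p != q ->
      visual x' (b p) (b q) = expR (- (D p q - Phi x' 0 p - Phi x' 0 q) / 2).
    by move=> pq; rewrite (visualE goodX) (inj_eq b_inj) (negbTE pq) log_visual_coords.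
  rewrite (cross_ratio_expR (vM _ _ ij) (vM _ _ i'j') (vM _ _ ij') (vM _ _ i'j)).
  rewrite (cross_ratio_expR (vX _ _ ij) (vX _ _ i'j') (vX _ _ ij') (vX _ _ i'j)).
  by congr expR; lra.
have [F Fiso Fext] := maxX.2 _ g goodM gM.
(* Because [F] extends [g], the Busemann function at [b i] can be computed along the image of the
   ray towards [i], where distances are those of the span. *)
have FB (s t : tspace D) i : busemann (F s) (F t) (b i) = sval t 0 i - sval s 0 i.
  have ri := endpointP (is_ray_ray_pt symD (origin span0) i).
  have rF := Fext _ _ ri; rewrite -/(pt i) gpt in rF.
  have h := busemann_cvg bcX (x := F s) (y := F t) rF.
  apply: (cvg_unique (@Rhausdorff R) h); apply: cvg_near_cst; near=> r.
  have r0 : 0 <= r by near: r; exact: nbhs_pinfty_ge.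
  have rs : K + `|sval s| < r by near: r; apply: nbhs_pinfty_gt; exact: num_real.
  have rt : K + `|sval t| < r by near: r; apply: nbhs_pinfty_gt; exact: num_real.
  have cr : sval (ray_pt symD (origin span0) i r) 0 i = r.
    by rewrite /= span_ray_coord//= mxE add0r.
  rewrite /= !Fiso (metric_sym s) (metric_sym t) !(far_mdist DK (i := i)) ?cr//.
  lra.
pose v := Phi (F (origin span0)).
have PhiF (t : tspace D) : Phi (F t) = sval t + v.
  apply/rowP => i; have := FB (origin span0) t i.
  rewrite !mxE (busemann_cocycle bcX x (F (origin span0))) => ->.
  by rewrite ?mxE; lra.
have v0 : v = 0.
  apply: (tight_span_translation symD span0) => w wT.
  by rewrite -(PhiF (exist _ w wT)); exact: busemann_coords_span.
by move=> uT; exists (F (exist _ u uT)); rewrite PhiF v0 addr0.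
Unshelve. all: by end_near. Qed.

End MaximalChart.

(* The pointed space [(X, x)] is the tight span of [D], with base point 0, and
   its boundary is the index set with semi-metric [exp (- D / 2)]. *)
Record tight_span_model {R : realType} (X : metricType R) (x : X) (n : nat)
    (D : 'I_n.+2 -> 'I_n.+2 -> R) := TightSpanModel {
  model_pt : 'I_n.+2 -> boundary X ;
  model_coords : X -> 'rV[R]_n.+2 ;
  model_pt_surj : forall xi, exists i, model_pt i = xi ;
  model_visual : forall i j, visual x (model_pt i) (model_pt j) =
    if i == j then 0 else expR (- D i j / 2) ;
  model_sym : forall i j, D i j = D j i ;
  model_isometry : forall y z, `|model_coords y - model_coords z| = mdist y z ;
  model_base : model_coords x = 0 ;
  model_span : forall y, tight_span D (model_coords y) ;
  model_coords_surj : forall u, tight_span D u -> exists y, model_coords y = u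
}.

Lemma maximal_model {R : realType} (X : metricType R) (x : X) :
  maximal_hyperbolic X -> finite_set [set: boundary X] ->
  exists n (D : 'I_n.+2 -> 'I_n.+2 -> R), inhabited (tight_span_model x D).
Proof.
move=> maxX finX; have goodX := maxX.1.
have [n [b [b_inj b_surj]]] := boundary_enum goodX finX.
exists n.+2, (log_matrix x b); split.
apply: (@TightSpanModel _ _ _ _ _ b (busemann_coords x b)) => //.
- by move=> i j; rewrite (visualE goodX) (inj_eq b_inj).
- exact: log_matrix_sym.
- exact: busemann_coords_isometry.
- exact: busemann_coords_base.
- exact: busemann_coords_span.
- exact: busemann_coords_surj.
Qed.

(** * Convergence *)

Section Clusters.
Context {R : realType} {m n : nat}.
Notation k' := m.+2.
Notation k := n.+2.
Variables (D' : 'I_k' -> 'I_k' -> R) (D : 'I_k -> 'I_k -> R).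
Hypothesis symD' : forall i j, D' i j = D' j i.
Hypothesis symD : forall i j, D i j = D j i.
Hypothesis span0' : tight_span D' 0.
Hypothesis span0 : tight_span D 0.

(* [f] collapses clusters of points at small visual distance (large [D']) and
   almost preserves [D'] between distinct clusters. *)
Definition cluster_map (a r : R) (f : 'I_k' -> 'I_k) :=
  [/\ forall j, exists i, f i = j,
      forall i j, i != j -> f i = f j -> r < D' i j &
      forall i j, f i != f j -> `|D' i j - D (f i) (f j)| <= a].

(** A pointed approximation between balls of radius [r], written in coordinates; values of [phi] off
    the span or outside the ball are irrelevant. *)
Definition span_approx (r e : R) (phi : 'rV[R]_k' -> 'rV[R]_k) :=
  [/\ phi 0 = 0,
      forall u, tight_span D' u -> `|u| <= r ->
        tight_span D (phi u) /\ `|phi u| <= r,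
      forall u v, tight_span D' u -> tight_span D' v -> `|u| <= r -> `|v| <= r ->
        `| `|phi u - phi v| - `|u - v| | <= e &
      forall w, tight_span D w -> `|w| <= r -> exists u,
        [/\ tight_span D' u, `|u| <= r & `|phi u - w| <= e]].

(** Reindexing along a section of [f] loses at most [4 * a] of a distance, and the two retractions
    move their points by [9 * a] each: hence [22 * a]. Pulling back along [f] shows that the image
    is almost everything. *)
Lemma cluster_map_span_approx (a r : R) f : 0 <= a -> 0 <= r ->
  cluster_map a (2 * r) f -> exists phi, span_approx r (22 * a) phi.
Proof.
move=> a0 r0 [/choice[s fs] same diff].
pose push (u : 'rV[R]_k') : 'rV[R]_k := \row_j u 0 (s j).
pose pull (w : 'rV[R]_k) : 'rV[R]_k' := \row_i w 0 (f i).
have pushB u v : push u - push v = push (u - v) by apply/rowP => j; rewrite !mxE.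
have pullB u v : pull u - pull v = pull (u - v) by apply/rowP => j; rewrite !mxE.
have push_le u : `|push u| <= `|u|.
  by apply/rV_normP => // j; rewrite mxE rV_norm_ge.
have pull_le u : `|pull u| <= `|u|.
  by apply/rV_normP => // j; rewrite mxE rV_norm_ge.
have push0 : push 0 = 0 by apply/rowP => j; rewrite !mxE.
have bnd (q : nat) (u : 'rV[R]_q) i : `|u| <= r -> - r <= u 0 i <= r.
  by move=> ur; rewrite -ler_norml; apply: le_trans (rV_norm_ge u i) ur.
have inD i j : f i != f j -> D (f i) (f j) - a <= D' i j <= D (f i) (f j) + a.
  by move=> /diff; rewrite ler_norml => /andP[? ?]; apply/andP; split; lra.
(* Inside the ball of radius [r] a tight pair has [D'] at most [2 * r], so it never lies in one
   cluster. *)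
have apart u i j : tight_span D' u -> `|u| <= r -> j != i ->
    u 0 i + u 0 j = D' i j -> f j != f i.
  move=> uT ur ji e; apply/eqP => fji; rewrite eq_sym in ji.
  have := same i j ji (esym fji); have := bnd _ u i ur; have := bnd _ u j ur.
  by move=> /andP[? ?] /andP[? ?]; lra.
(* Coordinates are almost constant on a cluster: the partner of [i] lies in another cluster, and its
   [D']-entries with [i] and [i'] agree up to [2 * a]. *)
have close u i i' : tight_span D' u -> `|u| <= r -> f i = f i' ->
    u 0 i' <= u 0 i + 2 * a.
  move=> uT ur fi; have [j ji e] := uT.2 i; have fji := apart u i j uT ur ji e.
  have fij : f i != f j by rewrite eq_sym.
  have i'j : i' != j by apply: contra_neq fij => <-.
  have := uT.1 i' j i'j; have /andP[] := inD i j fij.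
  have fi'j : f i' != f j by rewrite -fi.
  by have /andP[] := inD i' j fi'j; rewrite -fi; lra.
have push_near u : tight_span D' u -> `|u| <= r ->
    `|retract D (push u) - push u| <= 3 * (3 * a).
  move=> uT ur; apply: retract_near => // [|i j ij|i]; first lra.
    have sij : s i != s j by apply: contra_neq ij => e; rewrite -(fs i) -(fs j) e.
    rewrite !mxE; have := uT.1 _ _ sij.
    have fsij : f (s i) != f (s j) by rewrite !fs.
    by have /andP[] := inD (s i) (s j) fsij; rewrite !fs; lra.
  have [j js e] := uT.2 (s i); have fji := apart u (s i) j uT ur js e.
  have := fji; rewrite fs => fi; exists (f j) => //; rewrite !mxE.
  have := close u (s (f j)) j uT ur; rewrite fs => /(_ erefl).
  have fsj : f (s i) != f j by rewrite eq_sym.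
  by have /andP[] := inD (s i) j fsj; rewrite fs; lra.
have pull_near w : tight_span D w -> `|w| <= r ->
    `|retract D' (pull w) - pull w| <= 3 * a.
  move=> wT wr; apply: retract_near => // [i j ij|i].
    rewrite !mxE; have [fij|fij] := eqVneq (f i) (f j).
      have := same i j ij fij; have := bnd _ w (f i) wr; have := bnd _ w (f j) wr.
      by move=> /andP[? ?] /andP[? ?]; lra.
    by have := wT.1 _ _ fij; have /andP[] := inD i j fij; lra.
  have [j ji e] := wT.2 (f i); exists (s j).
    by apply: contra_neq ji => <-; rewrite fs.
  have fsj : f i != f (s j) by rewrite fs eq_sym.
  by rewrite !mxE fs; have /andP[] := inD i (s j) fsj; rewrite fs; lra.
exists (fun u => retract D (push u)); split.
- by rewrite push0 retract_fix.
- move=> u uT ur; split; first exact: retract_span.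
  have := retract_dist (push u) span0; rewrite !subr0 => h.
  exact: le_trans h (le_trans (push_le u) ur).
- move=> u v uT vT ur vr.
  have h1 : `|retract D (push u) - retract D (push v)| <= `|u - v|.
    by apply: le_trans (retract_lip _ _ _) _; rewrite pushB push_le.
  have h2 : `|u - v| <= `|push u - push v| + 4 * a.
    apply/rV_distP => [|i]; first by rewrite addr_ge0// mulr_ge0.
    have := rV_dist_ge (push u) (push v) (f i); rewrite !mxE.
    have c1 := close u i (s (f i)) uT ur; have c2 := close u (s (f i)) i uT ur.
    have c3 := close v i (s (f i)) vT vr; have c4 := close v (s (f i)) i vT vr.
    rewrite fs in c1 c2 c3 c4.
    have := c1 erefl; have := c2 erefl; have := c3 erefl; have := c4 erefl.
    by rewrite !ler_norml => ? ? ? ? /andP[? ?]; apply/andP; split; lra.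
  have n1 := push_near u uT ur; have n2 := push_near v vT vr.
  have := ler_distD (retract D (push u)) (push u) (push v).
  have := ler_distD (retract D (push v)) (retract D (push u)) (push v).
  rewrite (distrC (push u) (retract D (push u))) => t1 t2.
  by rewrite ler_norml; apply/andP; split; lra.
- move=> w wT wr; exists (retract D' (pull w)); split.
  + exact: retract_span.
  + have := retract_dist (pull w) span0'; rewrite !subr0 => h.
    exact: le_trans h (le_trans (pull_le w) wr).
  + apply: le_trans (retract_dist _ wT) _.
    have -> : push (retract D' (pull w)) - w = push (retract D' (pull w) - pull w).
      by apply/rowP => j; rewrite !mxE fs.
    apply: le_trans (push_le _) _; have := pull_near w wT wr; lra.
Qed.

(** Points at distance [r] towards [i] are sent to points with one coordinate in [[r - e, r]], hence
    beyond [K], and the index of that coordinate is [f i]. Distances between such images reveal [D]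
    up to [e] for each coordinate and [e] for the approximation, whence [3 * e]. *)
Lemma span_approx_cluster_map (K r e : R) phi : (forall i j, D i j <= K) ->
  0 <= K -> 0 < e -> K + 4 * e < r -> span_approx r e phi ->
  exists f, cluster_map (3 * e) (2 * r - 3 * e) f.
Proof.
move=> DK K0 e0 Kr [phi0 phiT phid phis].
have f0 := span0.1; have f0' := span0'.1.
have r0 : 0 <= r by lra.
(* [Y i] may contain many points, since [r] need not be large compared with [D']. *)
pose Y i (y : 'rV[R]_k') := [/\ tight_span D' y, `|y| <= r & y 0 i = r].
have Yext u i : tight_span D' u -> `|u| <= r -> u 0 i = `|u| ->
    exists2 y, Y i y & `|u - y| <= r - `|u|.
  move=> uT ur ui; have ru : 0 <= r - `|u| by rewrite subr_ge0.
  have d : `|u - span_ray D' u i (r - `|u|)| <= r - `|u|.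
    rewrite -{1}(span_ray0 i uT); apply: le_trans (span_ray_lip _ _ _ _ _) _.
    by rewrite sub0r normrN ger0_norm.
  exists (span_ray D' u i (r - `|u|)) => //; split; first exact: span_ray_span.
    have := ler_normB u (u - span_ray D' u i (r - `|u|)); rewrite subKr; lra.
  by rewrite span_ray_coord// ui; lra.
have Yex i : exists y, Y i y.
  have [||y Yy _] := Yext 0 i span0'; rewrite ?normr0 ?mxE//.
  by exists y.
have ends i y : Y i y -> exists j, r - e <= phi y 0 j <= r.
  move=> [yT yr yi]; have [pT pr] := phiT y yT yr.
  have [j [_ [_ pj _ _ _]]] := span_dist_attained span0 pT; exists j.
  rewrite mxE !subr0 in pj; rewrite pj.
  have := phid y 0 yT span0' yr; rewrite normr0 => /(_ r0).
  rewrite phi0 !subr0 ler_norml => /andP[h _].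
  by have := rV_norm_ge y i; rewrite yi ger0_norm// => ?; apply/andP; split; lra.
have uniq i y j l : Y i y -> K < phi y 0 j -> K < phi y 0 l -> j = l.
  move=> [yT yr _] hj hl; apply/eqP/negPn/negP => jl.
  by have := (phiT y yT yr).1.1 j l jl; have := DK j l; lra.
have same i j y y' l : Y i y -> Y j y' -> r - e <= phi y 0 l <= r ->
    r - e <= phi y' 0 l <= r -> `|y - y'| <= 2 * e.
  move=> [yT yr _] [y'T y'r _] /andP[l1 l2] /andP[l3 l4].
  have := phid y y' yT y'T yr y'r.
  have [k1 k2] : K < phi y 0 l /\ K < phi y' 0 l by lra.
  rewrite (far_dist_same symD f0 DK (phiT _ yT yr).1 (phiT _ y'T y'r).1 k1 k2).
  have : `|phi y 0 l - phi y' 0 l| <= e by rewrite ler_norml; apply/andP; split; lra.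
  by move=> h; rewrite ler_norml => /andP[? ?]; lra.
have diff i j y y' l l' : l != l' -> Y i y -> Y j y' -> r - e <= phi y 0 l <= r ->
    r - e <= phi y' 0 l' <= r ->
    2 * r - D l l' - 3 * e <= `|y - y'| <= 2 * r - D l l' + e.
  move=> ll' [yT yr _] [y'T y'r _] /andP[l1 l2] /andP[l3 l4].
  have := phid y y' yT y'T yr y'r.
  have [k1 k2] : K < phi y 0 l /\ K < phi y' 0 l' by lra.
  rewrite (far_dist_diff symD f0 DK (phiT _ yT yr).1 (phiT _ y'T y'r).1 ll' k1 k2).
  by rewrite ler_norml => /andP[? ?]; apply/andP; split; lra.
(* The image of [Y i] stays in one end: otherwise the retraction of a midpoint
   would be at distance at most [r] from points in two different ends. *)
have one_end i y y' l l' : Y i y -> Y i y' -> r - e <= phi y 0 l <= r ->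
    r - e <= phi y' 0 l' <= r -> l = l'.
  move=> Yy Yy' ly ly'; have [yT yr yi] := Yy; have [y'T y'r yi'] := Yy'.
  pose c : 'rV[R]_k' := 2^-1 *: (y + y').
  have cE j : c 0 j = (y 0 j + y' 0 j) / 2 by rewrite !mxE; lra.
  (* Feasibility is a convex condition, so retraction can only increase coordinate [i] of the
     midpoint, which is already [r], while the norm stays at most [r]. *)
  have Ym : Y i (retract D' c).
    have fc : feasible D' c.
      by move=> a b ab; rewrite !cE; have := yT.1 a b ab; have := y'T.1 a b ab; lra.
    have cr : `|c| <= r.
      rewrite normrZ ger0_norm ?invr_ge0//.
      by have := ler_normD y y'; lra.
    have mr : `|retract D' c| <= r.
      by have := retract_dist c span0'; rewrite !subr0 => h; exact: le_trans cr.
    split=> //; first exact: retract_span.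
    apply/eqP; rewrite eq_le; apply/andP; split.
      by apply: le_trans mr; apply: le_trans (rV_norm_ge _ i); exact: ler_norm.
    by apply: le_trans (retract_ge symD' i fc); rewrite cE yi yi'; lra.
  have yy' : `|y - y'| <= 2 * r by have := ler_normB y y'; lra.
  have half z z' : c = 2^-1 *: (z + z') -> tight_span D' z' -> `|z - z'| <= 2 * r ->
      `|retract D' c - z'| <= r.
    move=> -> z'T zz'; apply: le_trans (retract_dist _ z'T) _.
    have -> : 2^-1 *: (z + z') - z' = 2^-1 *: (z - z').
      by apply/rowP => j; rewrite !mxE; lra.
    by rewrite normrZ ger0_norm ?invr_ge0//; lra.
  have [l'' lm] := ends i _ Ym.
  have to z lz : Y i z -> `|retract D' c - z| <= r -> r - e <= phi z 0 lz <= r ->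
      l'' = lz.
    move=> Yz mz hz; apply/eqP/negPn/negP => ne.
    by have /andP[] := diff i i _ z l'' lz ne Ym Yz lm hz; have := DK l'' lz; lra.
  have hy' := half y y' erefl y'T yy'.
  rewrite distrC in yy'; have hy := half y' y (congr1 _ (addrC y y')) yT yy'.
  by rewrite -(to y l Yy hy ly) (to y' l' Yy' hy' ly').
have /choice[f fP] : forall i, exists l, forall y, Y i y -> r - e <= phi y 0 l <= r.
  move=> i; have [y Yy] := Yex i; have [l ly] := ends i y Yy; exists l => z Yz.
  by have [l' lz] := ends i z Yz; rewrite (one_end i y z l l').
exists f; split.
- move=> j; pose w := span_ray D 0 j r.
  have wT : tight_span D w by exact: span_ray_span.
  have wr : `|w| <= r.
    have := span_ray_lip D 0 j r 0; rewrite -/w span_ray0// !subr0.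
    by rewrite ger0_norm.
  have wj : w 0 j = r by rewrite span_ray_coord// mxE add0r.
  have [u [uT ur uw]] := phis w wT wr.
  have [i [_ [_ ui _ _ _]]] := span_dist_attained span0' uT.
  (* Here [|u| >= r - 2 * e], so [y] is within [2 * e] of [u] and [phi y] within [3 * e] of [phi u].
     As coordinate [j] of [phi u] is at least [r - e], that of [phi y] is at least [r - 4 * e],
     which exceeds [K]. *)
  rewrite mxE !subr0 in ui; have [y Yy yu] := Yext u i uT ur ui.
  exists i; have [yT yr _] := Yy.
  have d0 := phid u 0 uT span0' ur; rewrite normr0 phi0 !subr0 in d0.
  have := d0 r0; have := phid u y uT yT ur yr; rewrite !ler_norml.
  have := rV_dist_ge (phi u) w j; rewrite wj ler_norml => /andP[h1 h2].
  have := rV_norm_ge (phi u) j; rewrite ler_norml => /andP[h3 h4].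
  have := rV_dist_ge (phi u) (phi y) j; rewrite ler_norml => /andP[h5 h6].
  move=> /andP[h7 h8] /andP[h9 h10].
  have /andP[h11 h12] := fP i y Yy.
  by apply: (uniq i y) => //; lra.
- move=> i j ij fij; have [y Yy] := Yex i; have [y' Yy'] := Yex j.
  have h := fP j y' Yy'; rewrite -fij in h.
  have := same i j y y' (f i) Yy Yy' (fP i y Yy) h.
  have [yT _ yi] := Yy; have [_ _ y'j] := Yy'; have := yT.1 i j ij.
  have := rV_dist_ge y y' j; rewrite ler_norml => /andP[]; lra.
- move=> i j fij; have ij : i != j by apply: contra_neq fij => ->.
  rewrite ler_norml; apply/andP; split.
    have [y Yy] := Yex i; have [y' Yy'] := Yex j.
    have /andP[_] := diff i j y y' _ _ fij Yy Yy' (fP i y Yy) (fP j y' Yy').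
    have [yT _ yi] := Yy; have [_ _ y'j] := Yy'; have := yT.1 i j ij.
    have := rV_dist_ge y y' j; rewrite ler_norml => /andP[]; lra.
  (* The upper bound on [D'] needs points of [Y i] and [Y j] that are as close as possible. Both are
     reached by rays from a common point [w] with [w_i = w_j = |w| >= s], so their distance is at
     most [2 * (r - s)]. The minimum keeps [w] in the ball; the case [s = r] would give
     [2 * r <= K + 3 * e]. *)
  pose s := Num.min (D' i j / 2) r.
  have s0 : 0 <= s by rewrite le_min r0 divr_ge0// feasible0_ge0.
  have [sD sr] : s <= D' i j / 2 /\ s <= r by rewrite !ge_min !lexx orbT.
  pose u : 'rV[R]_k' := \row_l (if (l == i) || (l == j) then s else - s).
  have us l : `|u 0 l| <= s.
    by rewrite mxE; case: ifP => _; rewrite ?normrN ger0_norm.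
  have uF : feasible D' u.
    move=> a b ab; rewrite !mxE; have D0 := feasible0_ge0 f0' ab.
    have [aij|_] := boolP ((a == i) || (a == j)); last by case: ifP => _; lra.
    have [bij|_] := boolP ((b == i) || (b == j)); last by lra.
    suff -> : D' a b = D' i j by lra.
    move: ab; case/orP: aij => /eqP->; case/orP: bij => /eqP->; rewrite ?eqxx//.
  pose w := retract D' u; have wT : tight_span D' w by exact: retract_span.
  have ws : `|w| <= s.
    have := retract_dist u span0'; rewrite !subr0 => h.
    by apply: le_trans h _; apply/rV_normP.
  have wl l : (l == i) || (l == j) -> w 0 l = `|w|.
    move=> lij; have ul := retract_ge symD' l uF; rewrite mxE lij in ul.
    apply/eqP; rewrite eq_le; apply/andP; split.
      exact: le_trans (ler_norm _) (rV_norm_ge _ _).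
    exact: le_trans ws ul.
  have wr := le_trans ws sr.
  have ii : (i == i) || (i == j) by rewrite eqxx.
  have jj : (j == i) || (j == j) by rewrite eqxx orbT.
  have [y Yy yw] := Yext w i wT wr (wl i ii).
  have [y' Yy' y'w] := Yext w j wT wr (wl j jj).
  have /andP[h _] := diff i j y y' _ _ fij Yy Yy' (fP i y Yy) (fP j y' Yy').
  have := ler_distD w y y'; rewrite (distrC y w) => h1.
  have := retract_ge symD' i uF; rewrite mxE ii -/w => h2.
  have := ler_norm (w 0 i); have := rV_norm_ge w i => h3 h4.
  have := DK (f i) (f j); have [sE|sE] := leP (D' i j / 2) r.
    have : s = D' i j / 2 by rewrite /s (min_idPl sE).
    lra.
  have : s = r by rewrite /s min_r// ltW.
  lra.
Qed.

End Clusters.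

Lemma ereal_sup_le_real {R : realType} (T : Type) (S : set T) (h : T -> R) (e : R) :
  (ereal_sup [set (h p)%:E | p in S] < e%:E)%E -> forall p, S p -> h p < e.
Proof.
move=> H p Sp; rewrite -lte_fin; apply: le_lt_trans H.
by apply: ereal_sup_ubound; exists p.
Qed.

Lemma ereal_sup_lt_real {R : realType} (T : Type) (S : set T) (h : T -> R) (d e : R) :
  d < e -> (forall p, S p -> h p <= d) ->
  (ereal_sup [set (h p)%:E | p in S] < e%:E)%E.
Proof.
move=> de H; apply: (@le_lt_trans _ _ d%:E); last by rewrite lte_fin.
by apply: ge_ereal_sup => _ [p Sp <-]; rewrite lee_fin H.
Qed.

(** * Comparing visual distances with their logarithms *)

Section ExpBounds.
Context {R : realType}.

Lemma expR_lip_npos (p q : R) : p <= 0 -> q <= 0 -> `|expR p - expR q| <= `|p - q|.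
Proof.
suff H (a b : R) : a <= b -> b <= 0 -> `|expR a - expR b| <= `|a - b|.
  move=> p0 q0; have [pq|qp] := leP p q; first exact: H.
  by rewrite distrC (distrC p); exact: H (ltW qp) p0.
move=> ab b0; have e : expR a <= expR b by rewrite ler_expR.
rewrite distrC (distrC a) !ger0_norm ?subr_ge0//.
have -> : expR b - expR a = expR b * (1 - expR (a - b)).
  by rewrite mulrBr mulr1 -expRD subrKC.
have h := expR_ge1Dx (a - b).
have b1 : expR b <= 1 by rewrite -expR0 ler_expR.
apply: (@le_trans _ _ (1 - expR (a - b))); last lra.
by rewrite ler_piMl// subr_ge0 -expR0 ler_expR subr_le0.
Qed.

(* A lower bound on [rho = exp (- q / 2)] turns additive closeness into
   closeness of logarithms. *)
Lemma log_close (K a p q : R) : 0 < a -> q <= K ->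
  `|expR (- p / 2) - expR (- q / 2)| < expR (- K / 2) * (1 - expR (- a / 2)) ->
  `|p - q| <= a.
Proof.
move=> a0 qK; rewrite ltr_norml => /andP[h1 h2].
have a1 : expR (- a / 2) < 1 by rewrite expR_lt1; lra.
have qk : expR (- K / 2) <= expR (- q / 2) by rewrite ler_expR; lra.
have h3 : expR (- K / 2) * (1 - expR (- a / 2)) <=
    expR (- q / 2) * (1 - expR (- a / 2)).
  by rewrite ler_wpM2r// subr_ge0 ltW.
have lo : expR (- q / 2 - a / 2) < expR (- p / 2).
  have -> : expR (- q / 2 - a / 2) = expR (- q / 2) * expR (- a / 2).
    by rewrite -expRD; congr expR; lra.
  lra.
(* The given bound is [1 - expR (- a / 2)]; it is at most [expR (a / 2) - 1], by adding
   [1 + t <= expR t] for [t = a / 2] and [t = - a / 2]. *)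
have up : expR (- p / 2) < expR (- q / 2 + a / 2).
  rewrite expRD; apply: lt_le_trans (_ : expR (- q / 2) * (2 - expR (- a / 2)) <= _).
    lra.
  rewrite ler_pM2l ?expR_gt0//.
  have := expR_ge1Dx (- a / 2); have := expR_ge1Dx (a / 2); lra.
rewrite ltr_expR in lo; rewrite ltr_expR in up.
by rewrite ler_norml; apply/andP; split; lra.
Qed.

End ExpBounds.

(** * Transfer between spans, spaces and boundaries *)

Section ModelConvergence.
Context {R : realType} {X' X : metricType R} {x' : X'} {x : X} {m n : nat}.
Context {D' : 'I_m.+2 -> 'I_m.+2 -> R} {D : 'I_n.+2 -> 'I_n.+2 -> R}.
Variables (M' : tight_span_model x' D') (M : tight_span_model x D).

Lemma model_span0 (Y : metricType R) (y : Y) (p : nat) (E : 'I_p.+2 -> 'I_p.+2 -> R)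
  (N : tight_span_model y E) : tight_span E 0.
Proof. by rewrite -(model_base N); exact: model_span. Qed.

Lemma model_inv (Y : metricType R) (y : Y) (p : nat) (E : 'I_p.+2 -> 'I_p.+2 -> R)
  (N : tight_span_model y E) : exists g : 'rV[R]_p.+2 -> Y,
  (forall u, tight_span E u -> model_coords N (g u) = u) /\
  cancel (model_coords N) g.
Proof.
have inj : injective (model_coords N).
  move=> a b ab; apply: mdist_positivity.
  by rewrite -(model_isometry N) ab subrr normr0.
have /choice[g gP] : forall u, exists z, tight_span E u -> model_coords N z = u.
  move=> u; have [/(model_coords_surj N)[z zu]|uT] := pselect (tight_span E u).
    by exists z.
  by exists y => /uT.
exists g; split => // z; apply: inj; apply: gP; exact: model_span.
Qed.

Lemma model_pt_inj (Y : metricType R) (y : Y) (p : nat) (E : 'I_p.+2 -> 'I_p.+2 -> R)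
  (N : tight_span_model y E) : injective (model_pt N).
Proof.
move=> i j ij; apply/eqP/negPn/negP => ne.
have := model_visual N i j; rewrite (negbTE ne) ij (model_visual N) eqxx.
by move=> /esym e; have := expR_gt0 (- E i j / 2); rewrite e ltxx.
Qed.

Lemma GH_isometry_span_approx (r e : R) : 0 < r -> 0 < e ->
  (exists f : X' -> X, GH_isometry (cball x' r) (cball x r) e f /\ f x' = x) ->
  exists phi, span_approx D' D r e phi.
Proof.
move=> r0 e0 [f [[fB fd fs] fx]].
have [g [gK Kg]] := model_inv M'.
have n0 z : `|model_coords M z| = mdist x z.
  by rewrite metric_sym -(model_isometry M) (model_base M) subr0.
have n0' z : `|model_coords M' z| = mdist x' z.
  by rewrite metric_sym -(model_isometry M') (model_base M') subr0.
have gB u : tight_span D' u -> `|u| <= r -> cball x' r (g u).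
  by move=> uT ur; rewrite /cball/= -n0' gK.
exists (fun u => model_coords M (f (g u))); split.
- by rewrite -(model_base M') Kg fx (model_base M).
- move=> u uT ur; split; first exact: model_span.
  by rewrite n0; apply: fB; exact: gB.
- move=> u v uT vT ur vr; rewrite (model_isometry M) -{2}(gK u uT) -{2}(gK v vT).
  rewrite (model_isometry M') ltW//.
  exact: (ereal_sup_le_real fd (p := (g u, g v)) (conj (gB _ uT ur) (gB _ vT vr))).
- move=> w wT wr; have [y yw] := model_coords_surj M wT.
  have [|z zB zy] := fs y; first by rewrite /cball/= -n0 yw.
  exists (model_coords M' z); split; first exact: model_span.
    by rewrite n0'.
  by rewrite Kg -yw (model_isometry M).
Qed.

Lemma span_approx_GH_isometry (r d e : R) phi : 0 <= r -> d < e ->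
  span_approx D' D r d phi ->
  exists f : X' -> X, GH_isometry (cball x' r) (cball x r) e f /\ f x' = x.
Proof.
move=> r0 de [phi0 phiT phid phis].
have [g [gK Kg]] := model_inv M.
have n0 z : `|model_coords M z| = mdist x z.
  by rewrite metric_sym -(model_isometry M) (model_base M) subr0.
have n0' z : `|model_coords M' z| = mdist x' z.
  by rewrite metric_sym -(model_isometry M') (model_base M') subr0.
have zT := model_span M'.
exists (fun z => g (phi (model_coords M' z))); split; last first.
  by rewrite (model_base M') phi0 -(model_base M) Kg.
split.
- move=> z zr; have zr' : `|model_coords M' z| <= r by rewrite n0'.
  have [pT pr] := phiT _ (zT z) zr'.
  by rewrite /cball/= -n0 gK.
- apply: (ereal_sup_lt_real de) => -[y z] [/= yr zr].
  have yr' : `|model_coords M' y| <= r by rewrite n0'.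
  have zr' : `|model_coords M' z| <= r by rewrite n0'.
  rewrite -(model_isometry M) -(model_isometry M') !gK.
  + exact: phid.
  + by have [] := phiT _ (zT z) zr'.
  + by have [] := phiT _ (zT y) yr'.
- move=> y yr; have yr' : `|model_coords M y| <= r by rewrite n0.
  have [u [uT ur uy]] := phis _ (model_span M y) yr'.
  have [z zu] := model_coords_surj M' uT; exists z.
    by rewrite /cball/= -n0' zu.
  rewrite -(model_isometry M) zu gK; first exact: le_trans uy (ltW de).
  by have [] := phiT _ uT ur.
Qed.

(** Distinct points of the limit boundary are at visual distance at least [expR (- K / 2)], so
    almost reaching a point means reaching it, and [log_close] applies to distinct images. The bound
    [expR (- r / 2)] makes points with the same image a cluster. *)
Lemma AI_distance_lt_cluster_map (K a r e : R) : 0 < a -> (forall i j, D i j <= K) ->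
  e <= expR (- r / 2) -> e <= expR (- K / 2) * (1 - expR (- a / 2)) ->
  (AI_distance (visual x') (visual x) < e%:E)%E ->
  exists f, cluster_map D' D a r f.
Proof.
move=> a0 DK er eK; rewrite /AI_distance => /ereal_inf_lt[_ [d [d0 [F [Fd Fs]] _] <-]].
rewrite lte_fin => de.
have /choice[idx idxP] := model_pt_surj M.
pose f i := idx (F (model_pt M' i)).
have fF i : F (model_pt M' i) = model_pt M (f i) by rewrite idxP.
have close i j : `|visual x (model_pt M (f i)) (model_pt M (f j)) -
    visual x' (model_pt M' i) (model_pt M' j)| < d.
  by rewrite -!fF; exact: (ereal_sup_le_real Fd (p := (model_pt M' i, model_pt M' j)) I).
exists f; split.
- move=> j; have [zeta] := Fs (model_pt M j).
  have [i <-] := model_pt_surj M' zeta; rewrite fF (model_visual M) => h; exists i.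
  apply/eqP; move: h; case: eqP => // _ h.
  have : expR (- K / 2) <= expR (- D (f i) j / 2).
    by rewrite ler_expR; have := DK (f i) j; lra.
  have : expR (- K / 2) * (1 - expR (- a / 2)) <= expR (- K / 2).
    by rewrite ler_piMr ?expR_ge0// gerBl expR_ge0.
  lra.
- move=> i j ij fij; have := close i j.
  rewrite (model_visual M) (model_visual M') fij eqxx (negbTE ij) sub0r normrN.
  rewrite ger0_norm ?expR_ge0// => h.
  have : expR (- D' i j / 2) < expR (- r / 2) by lra.
  by rewrite ltr_expR; lra.
- move=> i j fij; have ij : i != j by apply: contra_neq fij => ->.
  have := close i j; rewrite (model_visual M) (model_visual M') (negbTE fij) (negbTE ij).
  rewrite distrC => h; apply: (log_close a0 (DK _ _)); lra.
Qed.

(** [f] and a section of it are the two approximations. Distinct clusters contribute an error [a],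
    since the exponential is 1-Lipschitz on nonpositive numbers; collapsing a cluster costs its
    diameter, at most [expR (- r / 2)]. *)
Lemma cluster_map_AI_distance (a r e : R) f : 0 < e -> a < e -> expR (- r / 2) < e ->
  cluster_map D' D a r f -> (AI_distance (visual x') (visual x) <= e%:E)%E.
Proof.
move=> e0 ae re [/choice[s fs] same diff].
have /choice[idx idxP] := model_pt_surj M.
have /choice[idx' idxP'] := model_pt_surj M'.
have ptK i : idx (model_pt M i) = i by apply: (model_pt_inj (N := M)); rewrite idxP.
have ptK' i : idx' (model_pt M' i) = i by apply: (model_pt_inj (N := M')); rewrite idxP'.
pose rho' i j : R := if i == j then 0 else expR (- D' i j / 2).
pose rho i j : R := if i == j then 0 else expR (- D i j / 2).
have D0 i j : i != j -> 0 <= D i j.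
  by have [h _] := model_span0 M; exact: feasible0_ge0.
have D0' i j : i != j -> 0 <= D' i j.
  by have [h _] := model_span0 M'; exact: feasible0_ge0.
pose d := Num.max a (expR (- r / 2)).
have de : d < e by rewrite gt_max ae.
have small i j : i != j -> f i = f j -> expR (- D' i j / 2) <= d.
  move=> ij fij; rewrite le_max; apply/orP; right; rewrite ler_expR.
  by have := same i j ij fij; lra.
have close i j : `|rho (f i) (f j) - rho' i j| <= d.
  have d0 : 0 <= d by rewrite le_max expR_ge0 orbT.
  rewrite /rho /rho'; have [fij|fij] := eqVneq (f i) (f j).
    have [ij|ij] := eqVneq i j; first by rewrite subr0 normr0.
    by rewrite sub0r normrN ger0_norm ?expR_ge0// small.
  have ij : i != j by apply: contra_neq fij => ->.
  rewrite (negbTE ij); have h := diff i j fij.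
  have h1 := D0 _ _ fij; have h2 := D0' _ _ ij.
  apply: le_trans (expR_lip_npos _ _) _; try lra.
  have da : a <= d by rewrite le_max lexx.
  move: h; rewrite !ler_norml => /andP[? ?]; apply/andP; split; lra.
apply: ereal_inf_lbound; exists e => //; split => //.
- exists (fun xi => model_pt M (f (idx' xi))); split.
    apply: (ereal_sup_lt_real de) => -[xi eta] _ /=.
    rewrite -{2}(idxP' xi) -{2}(idxP' eta) (model_visual M) (model_visual M').
    exact: close.
  move=> eta; exists (model_pt M' (s (idx eta))).
  by rewrite ptK' fs idxP -(idxP eta) (model_visual M) eqxx.
- exists (fun xi => model_pt M' (s (idx xi))); split.
    apply: (ereal_sup_lt_real de) => -[xi eta] _ /=.
    rewrite -{2}(idxP xi) -{2}(idxP eta) (model_visual M) (model_visual M') distrC.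
    by have := close (s (idx xi)) (s (idx eta)); rewrite !fs.
  move=> eta; exists (model_pt M (f (idx' eta))); rewrite ptK -{2}(idxP' eta).
  rewrite (model_visual M'); case: eqP => // /eqP ne.
  by apply: le_lt_trans de; apply: small; rewrite ?fs.
Qed.

End ModelConvergence.

Lemma AI_distance_ge0 {R : realType} (Z1 Z2 : Type) (rho1 : Z1 -> Z1 -> R)
  (rho2 : Z2 -> Z2 -> R) : (0 <= AI_distance rho1 rho2)%E.
Proof. by apply: le_ereal_inf_tmp => _ [e [/ltW e0 _ _] <-]; rewrite lee_fin. Qed.

Theorem corollary1p7 (R : realType)
  (X_ : nat -> metricType R) (x_ : forall n, X_ n)
  (X : metricType R) (x : X)
  (maxX_ : forall n, maximal_hyperbolic (X_ n))
  (finX_ : forall n, finite_set [set: boundary (X_ n)])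
  (maxX : maximal_hyperbolic X)
  (finX : finite_set [set: boundary X]) :
  pointed_GH_cvg x_ x <-> AI_cvg (fun n => visual (x_ n)) (visual x).
Proof.
have [k [D [M]]] := maximal_model x maxX finX.
have symD := model_sym M; have span0 := model_span0 M.
have [K K0 DK] := upper_bound_ex D.
split=> [GH A /nbhs_EFin/nbhs_ballP[e /= e0 eA]|AI r e r0 e0].
  (* The cluster map obtained below has parameters [3 * d = e / 4] and [2 * r - 3 * d]. The
     logarithm in [r] makes [expR (- (2 * r - 3 * d) / 2)] smaller than [e / 2], and aiming at
     [e / 2] leaves room for the strict inequality. *)
  pose d := e / 12; have d0 : 0 < d by rewrite divr_gt0.
  pose r := K + 7 * d + `|ln (e / 2)| + 1.
  have l0 := normr_ge0 (ln (e / 2)).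
  have r0 : 0 < r by rewrite /r; lra.
  have [n0 n0P] := GH r d r0 d0; exists n0 => // n /= /n0P isoF.
  have [k_ [D_ [M_]]] := maximal_model (x_ n) (maxX_ n) (finX_ n).
  have [phi phiP] := GH_isometry_span_approx M_ M r0 d0 isoF.
  have Kr : K + 4 * d < r by rewrite /r; lra.
  have [f fP] := span_approx_cluster_map (model_sym M_) symD (model_span0 M_) span0
    DK K0 d0 Kr phiP.
  have e20 : 0 < e / 2 by rewrite divr_gt0.
  have le : (AI_distance (visual (x_ n)) (visual x) <= (e / 2)%:E)%E.
    apply: (cluster_map_AI_distance M_ M e20 _ _ fP).
      by rewrite /d; lra.
    rewrite -[ltRHS](@lnK R) ?posrE// ltr_expR.
    have := ler_norm (- ln (e / 2)); rewrite normrN /r; lra.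
  have ge := AI_distance_ge0 (visual (x_ n)) (visual x).
  have fin : AI_distance (visual (x_ n)) (visual x) \is a fin_num.
    by rewrite fin_numElt (lt_le_trans _ ge) ?ltNy0// (le_lt_trans le) ?ltry.
  rewrite -(fineK fin) lee_fin in le; rewrite -(fineK fin) lee_fin in ge.
  rewrite -(fineK fin); apply: eA; rewrite -ball_normE/= sub0r normrN ger0_norm//.
  lra.
(* The approximation built from the cluster map has error [22 * a = e / 2]. The first term of [e']
   gives clusters with [D'] above [2 * r], as required on balls of radius [r]. *)
pose a := e / 44; have a0 : 0 < a by rewrite divr_gt0.
pose e' := Num.min (expR (- (2 * r) / 2)) (expR (- K / 2) * (1 - expR (- a / 2))).
have e'0 : 0 < e'.
  by rewrite lt_min expR_gt0 mulr_gt0 ?expR_gt0// subr_gt0 expR_lt1; lra.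
have nb : nbhs 0%E [set z : \bar R | (z < e'%:E)%E].
  by apply: open_nbhs_nbhs; split; [exact: open_ereal_lt_ereal|rewrite /= lte_fin].
have [n0 _ n0P] := AI _ nb.
exists n0 => n /n0P lt.
have [k_ [D_ [M_]]] := maximal_model (x_ n) (maxX_ n) (finX_ n).
have [e'1 e'2] : e' <= expR (- (2 * r) / 2) /\
    e' <= expR (- K / 2) * (1 - expR (- a / 2)) by rewrite !ge_min !lexx orbT.
have [f fP] := AI_distance_lt_cluster_map M_ M a0 DK e'1 e'2 lt.
have [phi phiP] := cluster_map_span_approx (model_sym M_) symD (model_span0 M_) span0
  (ltW a0) (ltW r0) fP.
by apply: (span_approx_GH_isometry M_ M (ltW r0) _ phiP); rewrite /a; lra.
Qed.
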